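(* Let $m,n\ge1$, fix $\rho\in\mathbb{C}$ and $u,v\in\mathbb{C}$ with $uv=-\theta$, and let $\mathcal{A}_{m,n}(z,w)$ be the universal transfer matrix described in the context. Set $\mathcal{A}_{m,n}(z)=\mathcal{A}_{m,n}(z,\rho z)$. Then $\mathcal{A}_{m,n}(z)$ is a generating function for a commutative family of elements of $\mathrm{qwB}_{m,n}$: $$\mathcal{A}_{m,n}(z)\,\mathcal{A}_{m,n}(w)-\mathcal{A}_{m,n}(w)\,\mathcal{A}_{m,n}(z)=0.$$
   Context: $\mathcal{B}$ is the $\mathbb{C}$-linear strict monoidal braided category whose objects are tensor words in $X$ and $X^*$, with braiding $c_{A,B}$ and duality morphisms $\mathrm{ev}_{\bullet\circ}:X^*\otimes X\to\mathbf 1$, $\mathrm{ev}_{\circ\bullet}:X\otimes X^*\to\mathbf 1$, $\mathrm{coev}_{\bullet\circ}:\mathbf 1\to X^*\otimes X$, $\mathrm{coev}_{\circ\bullet}:\mathbf 1\to X\otimes X^*$ satisfying the zigzag identities (morphisms are tangles modulo isotopy), subject to: $c_{X,X}^2=-\alpha\beta\,\mathrm{id}+(\alpha+\beta)c_{X,X}$; $c_{X,X^*}\circ\mathrm{coev}_{\circ\bullet}=\kappa\,\mathrm{coev}_{\bullet\circ}$; $c_{X^*,X}\circ\mathrm{coev}_{\bullet\circ}=\kappa'\,\mathrm{coev}_{\circ\bullet}$; $\mathrm{ev}_{\circ\bullet}\circ\mathrm{coev}_{\circ\bullet}=\frac{\theta+1}{\kappa'(\alpha+\beta)}$, $\mathrm{ev}_{\bullet\circ}\circ\mathrm{coev}_{\bullet\circ}=\frac{\theta+1}{\kappa(\alpha+\beta)}$,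 with $\theta=\alpha\beta\kappa\kappa'$. $V_{m,n}=(X^* )^{\otimes m}\otimes X^{\otimes n}$, factors labelled left to right $m',\dots,1',1,\dots,n$; $\mathrm{qwB}_{m,n}$ is the algebra generated in $\mathrm{End}_{\mathcal B}(V_{m,n})$ by $g_j$ ($c_{X^*,X^*}$ on factors $(j+1)',j'$), $h_i$ ($c_{X,X}$ on factors $i,i+1$) and $E$ ($\mathrm{coev}_{\bullet\circ}\circ\mathrm{ev}_{\bullet\circ}$ on factors $1',1$). Baxterized crossings: $R_{XX}(z)=c_{X,X}+\frac{\alpha+\beta}{z-1}\mathrm{id}$, $R_{X^*X^*}(z)=c_{X^*,X^*}+\frac{\alpha+\beta}{z-1}\mathrm{id}$, $R_{X^*X}(z)=c_{X^*,X}+\frac{\alpha+\beta}{\alpha\beta}\frac{u}{z-u}\mathrm{coev}_{\circ\bullet}\circ\mathrm{ev}_{\bullet\circ}$, $R_{XX^*}(z)=c_{X,X^*}+\frac{\alpha+\beta}{\alpha\beta}\frac{v}{z-v}\mathrm{coev}_{\bullet\circ}\circ\mathrm{ev}_{\circ\bullet}$. Let $T_z:X^*\otimes V_{m,n}\to V_{m,n}\otimes X^*$ move the extra leftmost $X^*$ factor right past factors $m',\dots,1'$ via $R_{X^*X^*}(z)$ and then past $1,\dots,n$ via $R_{X^*X}(z)$; let $S_w:V_{m,n}\otimes X^*\to X^*\otimes V_{m,n}$ move it back past $n,\dots,1$ via $R_{XX^*}(w)$ and then past $1',\dots,m'$ via $R_{X^*X^*}(w)$. Then $\kappa(\alpha+\beta)\mathcal{A}_{m,n}(z,w)=(\mathrm{ev}_{\circ\bullet}\otimes\mathrm{id})\circ(\mathrm{id}_X\otimes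 S_w)\circ(\mathrm{id}_X\otimes T_z)\circ(\mathrm{coev}_{\circ\bullet}\otimes\mathrm{id})$. *)

(* Defs.v *)
From HB Require Import structures.
From mathcomp Require Import all_boot all_order all_algebra.
From mathcomp Require Import complex.
From mathcomp Require Import Rstruct.
Set Implicit Arguments. Unset Strict Implicit. Unset Printing Implicit Defensive.
Import GRing.Theory.
Local Open Scope ring_scope.

Definition CC : fieldType := (Rdefinitions.R)[i].

(* Objects: tensor words in X (= true) and Xd (= false). *)
Definition word := seq bool.
Definition oX : bool := true.
Definition oXd : bool := false.

Record catData (K : fieldType) := CatData {
  Hom : word -> word -> lmodType K;
  compo : forall A B C, Hom B C -> Hom A B -> Hom A C;
  idm : forall A, Hom A A;
  tens : forall A B C D, Hom A B -> Hom C D -> Hom (A ++ C) (B ++ D);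
  br : forall A B, Hom (A ++ B) (B ++ A);
  brinv : forall A B, Hom (B ++ A) (A ++ B);
  ev_dX : Hom [:: oXd; oX] [::];
  ev_Xd : Hom [:: oX; oXd] [::];
  coev_dX : Hom [::] [:: oXd; oX];
  coev_Xd : Hom [::] [:: oX; oXd]
}.

Arguments compo {K} c {A B C}.
Arguments idm {K} c A.
Arguments tens {K} c {A B C D}.
Arguments br {K} c A B.
Arguments brinv {K} c A B.
Arguments ev_dX {K} c.
Arguments ev_Xd {K} c.
Arguments coev_dX {K} c.
Arguments coev_Xd {K} c.

(* Transport of a morphism along equalities of words (decided by ==);  *)
(* it is only ever used when the words are indeed equal.               *)
Definition castH (K : fieldType) (C : catData K) (A B A' B' : word)
    (f : Hom C A B) : Hom C A' B' :=
  match A =P A', B =P B' with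
  | ReflectT eA, ReflectT eB =>
      eq_rect A (fun A0 => Hom C A0 B') (eq_rect B (fun B0 => Hom C A B0) f B' eB) A' eA
  | _, _ => 0
  end.
Arguments castH {K} C {A B A' B'} f.

Definition braided_dual_cat (K : fieldType) (C : catData K) : Prop :=
  (forall A B D (a : K) (f g : Hom C B D) (h : Hom C A B),
      compo C (a *: f + g) h = a *: compo C f h + compo C g h) /\
  (forall A B D (a : K) (f : Hom C B D) (g h : Hom C A B),
      compo C f (a *: g + h) = a *: compo C f g + compo C f h) /\
  (forall A B D E (f : Hom C D E) (g : Hom C B D) (h : Hom C A B),
      compo C f (compo C g h) = compo C (compo C f g) h) /\
  (forall A B (f : Hom C A B), compo C (idm C B) f = f) /\
  (forall A B (f : Hom C A B), compo C f (idm C A) = f) /\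
  (forall A B A' B' (a : K) (f g : Hom C A B) (h : Hom C A' B'),
      tens C (a *: f + g) h = a *: tens C f h + tens C g h) /\
  (forall A B A' B' (a : K) (f : Hom C A B) (g h : Hom C A' B'),
      tens C f (a *: g + h) = a *: tens C f g + tens C f h) /\
  (forall A B D A' B' D' (f : Hom C B D) (g : Hom C A B)
          (f' : Hom C B' D') (g' : Hom C A' B'),
      tens C (compo C f g) (compo C f' g') = compo C (tens C f f') (tens C g g')) /\
  (forall A B, tens C (idm C A) (idm C B) = idm C (A ++ B)) /\
  (forall A1 B1 A2 B2 A3 B3 (f1 : Hom C A1 B1) (f2 : Hom C A2 B2) (f3 : Hom C A3 B3),
      castH C (tens C (tens C f1 f2) f3) = tens C f1 (tens C f2 f3)) /\
  (forall A B (f : Hom C A B), tens C (idm C [::]) f = f) /\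
  (forall A B (f : Hom C A B), castH C (tens C f (idm C [::])) = f) /\
  (forall A B A' B' (f : Hom C A B) (g : Hom C A' B'),
      compo C (br C B B') (tens C f g) = compo C (tens C g f) (br C A A')) /\
  (forall A B, compo C (brinv C A B) (br C A B) = idm C (A ++ B)) /\
  (forall A B, compo C (br C A B) (brinv C A B) = idm C (B ++ A)) /\
  (forall A B D,
      br C A (B ++ D) =
      castH C (compo C (tens C (idm C B) (br C A D))
                      (castH C (tens C (br C A B) (idm C D)) : Hom C (A ++ (B ++ D)) (B ++ (A ++ D))))) /\
  (forall A B D,
      br C (A ++ B) D =
      castH C (compo C (tens C (br C A D) (idm C B))
                      (castH C (tens C (idm C A) (br C B D)) : Hom C ((A ++ B) ++ D) ((A ++ D) ++ B)))) /\
  compo C (tens C (idm C [:: oX]) (ev_dX C)) (tens C (coev_Xd C) (idm C [:: oX]))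
    = idm C [:: oX] /\
  compo C (tens C (ev_dX C) (idm C [:: oXd])) (tens C (idm C [:: oXd]) (coev_Xd C))
    = idm C [:: oXd] /\
  compo C (tens C (ev_Xd C) (idm C [:: oX])) (tens C (idm C [:: oX]) (coev_dX C))
    = idm C [:: oX] /\
  compo C (tens C (idm C [:: oXd]) (ev_Xd C)) (tens C (coev_dX C) (idm C [:: oXd]))
    = idm C [:: oXd].

Definition B_relations (C : catData CC) (al be ka ka' : CC) : Prop :=
  let th := al * be * ka * ka' in
  compo C (br C [:: oX] [:: oX]) (br C [:: oX] [:: oX])
    = - (al * be) *: idm C [:: oX; oX] + (al + be) *: br C [:: oX] [:: oX] /\
  compo C (br C [:: oX] [:: oXd]) (coev_Xd C) = ka *: coev_dX C /\
  compo C (br C [:: oXd] [:: oX]) (coev_dX C) = ka' *: coev_Xd C /\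
  compo C (ev_Xd C) (coev_Xd C) = ((th + 1) / (ka' * (al + be))) *: idm C [::] /\
  compo C (ev_dX C) (coev_dX C) = ((th + 1) / (ka * (al + be))) *: idm C [::].

(* V_{m,n} = (Xd)^{(x) m} (x) X^{(x) n}; factors m',...,1',1,...,n. *)
Definition Vmn (m n : nat) : word := nseq m oXd ++ nseq n oX.

Definition loc (C : catData CC) (L R : word) (a b c d : bool)
    (f : Hom C [:: a; b] [:: c; d]) (W W' : word) : Hom C W W' :=
  castH C (tens C (idm C L) (tens C f (idm C R))).

(* Generators of qwB_{m,n}.  Factor k' sits at position m - k, factor  *)
(* i at position m + i - 1 (positions counted from 0, left to right).   *)
Definition gen_g (C : catData CC) (m n j : nat) : Hom C (Vmn m n) (Vmn m n) :=
  loc (take (m - j.+1) (Vmn m n)) (drop (m - j.+1).+2 (Vmn m n))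
      (br C [:: oXd] [:: oXd]) (Vmn m n) (Vmn m n).
Definition gen_h (C : catData CC) (m n i : nat) : Hom C (Vmn m n) (Vmn m n) :=
  loc (take (m + i - 1) (Vmn m n)) (drop (m + i - 1).+2 (Vmn m n))
      (br C [:: oX] [:: oX]) (Vmn m n) (Vmn m n).
Definition gen_E (C : catData CC) (m n : nat) : Hom C (Vmn m n) (Vmn m n) :=
  loc (take (m - 1) (Vmn m n)) (drop (m - 1).+2 (Vmn m n))
      (compo C (coev_dX C) (ev_dX C)) (Vmn m n) (Vmn m n).

Inductive in_qwB (C : catData CC) (m n : nat) : Hom C (Vmn m n) (Vmn m n) -> Prop :=
| qwB_id : in_qwB (idm C (Vmn m n))
| qwB_g j : (1 <= j < m)%N -> in_qwB (gen_g C m n j)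
| qwB_h i : (1 <= i < n)%N -> in_qwB (gen_h C m n i)
| qwB_E : in_qwB (gen_E C m n)
| qwB_add f g : in_qwB f -> in_qwB g -> in_qwB (f + g)
| qwB_scale (a : CC) f : in_qwB f -> in_qwB (a *: f)
| qwB_comp f g : in_qwB f -> in_qwB g -> in_qwB (compo C f g).

Definition Rx (C : catData CC) (al be u v : CC) (a b : bool) (z : CC)
    : Hom C [:: a; b] [:: b; a] :=
  match a, b return Hom C [:: a; b] [:: b; a] with
  | true, true =>
      br C [:: oX] [:: oX] + ((al + be) / (z - 1)) *: idm C [:: oX; oX]
  | false, false =>
      br C [:: oXd] [:: oXd] + ((al + be) / (z - 1)) *: idm C [:: oXd; oXd]
  | false, true =>
      br C [:: oXd] [:: oX]
      + ((al + be) / (al * be) * (u / (z - u))) *: compo C (coev_Xd C) (ev_dX C)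
  | true, false =>
      br C [:: oX] [:: oXd]
      + ((al + be) / (al * be) * (v / (z - v))) *: compo C (coev_dX C) (ev_Xd C)
  end.

Definition ins (V : word) (k : nat) : word := take k V ++ oXd :: drop k V.

Definition Tstep (C : catData CC) al be u v (V : word) (z : CC) (k : nat)
    : Hom C (ins V k) (ins V k.+1) :=
  loc (take k V) (drop k.+1 V) (Rx C al be u v oXd (nth oX V k) z) _ _.
Definition Sstep (C : catData CC) al be u v (V : word) (w : CC) (k : nat)
    : Hom C (ins V k.+1) (ins V k) :=
  loc (take k V) (drop k.+1 V) (Rx C al be u v (nth oX V k) oXd w) _ _.

Fixpoint Tchain (C : catData CC) al be u v V z (k : nat) : Hom C (ins V 0) (ins V k) :=
  match k with
  | 0 => idm C _
  | k'.+1 => compo C (Tstep C al be u v V z k') (Tchain C al be u v V z k')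
  end.
Fixpoint Schain (C : catData CC) al be u v V w (k : nat) : Hom C (ins V k) (ins V 0) :=
  match k with
  | 0 => idm C _
  | k'.+1 => compo C (Schain C al be u v V w k') (Sstep C al be u v V w k')
  end.

Definition Tz (C : catData CC) al be u v (V : word) (z : CC)
    : Hom C (oXd :: V) (V ++ [:: oXd]) :=
  castH C (Tchain C al be u v V z (size V)).
Definition Sw (C : catData CC) al be u v (V : word) (w : CC)
    : Hom C (V ++ [:: oXd]) (oXd :: V) :=
  castH C (Schain C al be u v V w (size V)).

Definition Amn (C : catData CC) (al be ka u v : CC) (m n : nat) (z w : CC)
    : Hom C (Vmn m n) (Vmn m n) :=
  let V := Vmn m n in
  (ka * (al + be))^-1 *:
  compo C (tens C (ev_Xd C) (idm C V))
    (compo C (tens C (idm C [:: oX]) (Sw C al be u v V w))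
      (compo C (tens C (idm C [:: oX]) (Tz C al be u v V z))
         (tens C (coev_Xd C) (idm C V)))).

(* z is not a pole of A_{m,n}(z, rho z): the crossings of T_z involve    *)
(* 1/(z-1) and u/(z-u), those of S_{rho z} involve 1/(rho z - 1) and      *)
(* v/(rho z - v) (u/(z-u) is identically 0 as a rational function when    *)
(* u = 0, and likewise for v; mathcomp's 0/0 = 0 matches this).          *)
Definition regular_pt (rho u v z : CC) : Prop :=
  z != 1 /\ (u != 0 -> z != u) /\ rho * z != 1 /\ (v != 0 -> rho * z != v).

(* Main.v *)
(** Sliding a strand from the left end of a word inwards shows that the operator
    [D_V(z) = S_w T_z], [w = rho z], on [X* (x) V] satisfies
    [D_{xV}(z) = R_{xX*}(rho z) (id_x (x) D_V(z)) R_{X*x}(z)].  By the spectral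
    Yang-Baxter equations (the mixed one uses [uv = - theta]) this dressing
    preserves Sklyanin's reflection equation
    [R(z/w) D_1(z) R(rho z w) D_1(w) = D_1(w) R(rho z w) D_1(z) R(z/w)],
    so all [D_V] satisfy it.  Closing both auxiliary strands, using that the double
    closure is cyclic for the auxiliary crossing [g] and that the closure of
    [g (id (x) D) g^-1] is [id (x) (closure of D)], yields the commutation
    relation whenever a few scalars polynomial in [z] do not vanish; since the
    commutator, cleared of denominators, is polynomial in [z], it vanishes identically.

    For membership, the closure of [g (id (x) D) g] reduces by the skein relation to
    [D] and [id (x) (closure of D)]: this peels off the [X*] factors one by one, and
    for [m = 0] the operator [D] lies in [H + H E H], where [H] is the Hecke algebra
    on the [X] strands, and closes into [H]. *)

Require Import Defs.
From HB Require Import structures.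
From mathcomp Require Import all_boot all_order all_algebra ring zify.
From mathcomp Require Import complex Rstruct.
Import GRing.Theory.
Import Defs.
Local Open Scope ring_scope.
Set Implicit Arguments. Unset Strict Implicit. Unset Printing Implicit Defensive.

(** * Reflexive comparison of linear combinations *)

Inductive lin_expr (K : Type) :=
| LVar of nat | LZero | LAdd of lin_expr K & lin_expr K | LOpp of lin_expr K
| LScale of K & lin_expr K.
Arguments LVar {K}. Arguments LZero {K}.

Fixpoint lin_eval (K : pzRingType) (V : lmodType K) (env : seq V) (e : lin_expr K) : V :=
  match e with
  | LVar j => nth 0 env j
  | LZero => 0
  | LAdd a b => lin_eval env a + lin_eval env b
  | LOpp a => - lin_eval env a
  | LScale k a => k *: lin_eval env a
  end.

(** Indices are compared by [Nat.eqb], which [cbn] evaluates on the numerals produced by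
    reification. *)
Fixpoint lin_coef (K : pzRingType) (i : nat) (e : lin_expr K) : K :=
  match e with
  | LVar j => if Nat.eqb j i then 1 else 0
  | LZero => 0
  | LAdd a b => lin_coef i a + lin_coef i b
  | LOpp a => - lin_coef i a
  | LScale k a => k * lin_coef i a
  end.

(** A nested conjunction rather than a quantified statement, so that [repeat split] leaves one
    scalar equation per atom. *)
Fixpoint lin_same (K : pzRingType) (n : nat) (e1 e2 : lin_expr K) : Prop :=
  if n is n'.+1 then lin_coef n' e1 = lin_coef n' e2 /\ lin_same n' e1 e2 else True.

Lemma lin_evalE (K : pzRingType) (V : lmodType K) (env : seq V) (e : lin_expr K) :
  lin_eval env e = \sum_(i < size env) lin_coef i e *: nth 0 env i.
Proof.
elim: e => [j||a IHa b IHb|a IHa|k a IHa] /=.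
- have [lt_j|ge_j] := ltnP j (size env).
    rewrite (bigD1 (Ordinal lt_j)) //= PeanoNat.Nat.eqb_refl scale1r big1 ?addr0 // => i ne_i.
    case E : (Nat.eqb j i); last by rewrite scale0r.
    move/PeanoNat.Nat.eqb_eq: E => E.
    by case/eqP: ne_i; apply: val_inj.
  rewrite nth_default // big1 // => i _.
  case E : (Nat.eqb j i); last by rewrite scale0r.
  move/PeanoNat.Nat.eqb_eq: E ge_j => ->.
  by rewrite leqNgt ltn_ord.
- by rewrite big1 // => i _; rewrite scale0r.
- by rewrite IHa IHb -big_split; apply: eq_bigr => i _; rewrite scalerDl.
- by rewrite IHa -sumrN; apply: eq_bigr => i _; rewrite scaleNr.
- by rewrite IHa scaler_sumr; apply: eq_bigr => i _; rewrite scalerA.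
Qed.

Lemma lin_eqP (K : pzRingType) (V : lmodType K) (env : seq V) (e1 e2 : lin_expr K) :
  lin_same (size env) e1 e2 -> lin_eval env e1 = lin_eval env e2.
Proof.
rewrite !lin_evalE => H; apply: eq_bigr => i _; congr (_ *: _).
elim: (size env) i H => [[]//|n IHn] i /= [En Hn].
have [lt_in|] := ltnP i n; first exact: (IHn (Ordinal lt_in)).
by rewrite leq_eqVlt ltnNge -ltnS ltn_ord orbF => /eqP <-.
Qed.

Ltac lin_index x env :=
  lazymatch env with
  | x :: _ => constr:(O)
  | _ :: ?t => let n := lin_index x t in constr:(S n)
  end.
Ltac lin_atoms e env :=
  lazymatch e with
  | (?a + ?b)%R => let env' := lin_atoms a env in lin_atoms b env'
  | (- ?a)%R => lin_atoms a env
  | (_ *: ?a)%R => lin_atoms a env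
  | 0%R => env
  | _ => match env with
         | _ => let _ := lin_index e env in env
         | _ => constr:(e :: env)
         end
  end.
Ltac lin_reify K e env :=
  lazymatch e with
  | (?a + ?b)%R => let a' := lin_reify K a env in let b' := lin_reify K b env in
                   constr:(@LAdd K a' b')
  | (- ?a)%R => let a' := lin_reify K a env in constr:(@LOpp K a')
  | (?k *: ?a)%R => let a' := lin_reify K a env in constr:(@LScale K k a')
  | 0%R => constr:(@LZero K)
  | _ => let n := lin_index e env in constr:(@LVar K n)
  end.
Ltac lin_coefs_in K V :=
  lazymatch goal with
  | |- @eq _ ?l ?r =>
    let env0 := lin_atoms l (@nil (GRing.Lmodule.sort V)) in
    let env := lin_atoms r env0 in
    let l' := lin_reify K l env in
    let r' := lin_reify K r env in
    apply: (@lin_eqP K V env l' r'); cbn [lin_same lin_coef size Nat.eqb];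
    repeat split
  end.
(* Reduces an equality of linear combinations of morphisms to the equality     *)
(* of the coefficients of each non-linear subterm.                             *)
Ltac lin_coefs :=
  lazymatch goal with
  | |- @eq ?T _ _ =>
    lazymatch T with context [@Hom ?K ?C ?A ?B] => lin_coefs_in K (@Hom K C A B) end
  end.

(** * Polynomial maps into a vector space *)

Section PolynomialMaps.
Variables (K : fieldType).

(* [F] is a polynomial of degree less than [n] with coefficients in [V], in Horner form. *)
Fixpoint poly_lt (V : lmodType K) (n : nat) (F : K -> V) : Prop :=
  if n is n'.+1 then
    exists G c, poly_lt n' G /\ forall z, F z = z *: G z + c
  else forall z, F z = 0.

Definition poly_map (V : lmodType K) (F : K -> V) := exists n, poly_lt n F.

(** Synthetic division in Horner form: if [F z = z *: G z + c] and [G z = G r + (z - r) *: H z],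
    then the quotient of [F] is [z *: H z + G r]. *)
Lemma poly_lt_divX (V : lmodType K) n (F : K -> V) r : poly_lt n.+1 F ->
  exists2 G, poly_lt n G & forall z, F z = F r + (z - r) *: G z.
Proof.
elim: n F => [|n IHn] F [G [c [HG EF]]].
  by exists (fun=> 0) => // z; rewrite !EF !HG !scaler0 addr0.
have [H HH EG] := IHn _ HG.
exists (fun z => z *: H z + G r); first by exists H, (G r).
by move=> z; rewrite !EF EG; lin_coefs_in K V; ring.
Qed.

Lemma poly_map_add (V : lmodType K) (F G : K -> V) :
  poly_map F -> poly_map G -> poly_map (fun z => F z + G z).
Proof.
case=> n Fn [m Gm].
elim: n F G m Fn Gm => [|n IHn] F G m.
  move=> /= F0 Gm; exists m; case: m Gm => [G0 z|m [H [c [HH EG]]]].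
    by rewrite F0 G0 addr0.
  by exists H, c; split=> // z; rewrite F0 EG add0r.
case=> F' [c [HF' EF]]; case: m => [G0|m [G' [d [HG' EG]]]].
  exists n.+1, F', c; split=> // z.
  by rewrite EF (G0 z) addr0.
have [k Hk] := IHn _ _ _ HF' HG'.
exists k.+1, (fun z => F' z + G' z), (c + d); split=> // z.
by rewrite EF EG scalerDr addrACA.
Qed.

Lemma poly_map_const (V : lmodType K) (c : V) : poly_map (fun=> c).
Proof. by exists 1%N, (fun=> 0), c; split=> // z; rewrite scaler0 add0r. Qed.

Lemma poly_map_scale (V : lmodType K) (F : K -> V) :
  poly_map F -> poly_map (fun z => z *: F z).
Proof.
by case=> n Fn; exists n.+1, F, 0; split=> // z; rewrite addr0.
Qed.

Lemma poly_map_ext (V : lmodType K) (F G : K -> V) :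
  (forall z, F z = G z) -> poly_map G -> poly_map F.
Proof.
move=> E [[|n] Gn]; first by exists 0%N => z; rewrite E Gn.
by case: Gn => H [c [HH EG]]; exists n.+1, H, c; split=> // z; rewrite E EG.
Qed.

Lemma poly_map_affine (V : lmodType K) (a b : K) (c d : V) :
  poly_map (fun z => (a * z - b) *: c + d).
Proof.
apply: poly_map_add (poly_map_const d).
apply: (@poly_map_ext _ _ (fun z => z *: (a *: c) + (- b) *: c)).
  by move=> z; rewrite scalerA mulrC -scalerDl.
by apply: poly_map_add (poly_map_const _); apply/poly_map_scale/poly_map_const.
Qed.

Lemma poly_map_lin (V W : lmodType K) (f : V -> W) (F : K -> V) :
  (forall x y, f (x + y) = f x + f y) -> (forall a x, f (a *: x) = a *: f x) ->
  poly_map F -> poly_map (fun z => f (F z)).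
Proof.
move=> fD fZ [n Fn]; elim: n F Fn => [|n IHn] F.
  move=> F0; exists 0%N => z; rewrite F0 -(scale0r 0) fZ scale0r //.
case=> G [c [HG EF]].
apply: (@poly_map_ext _ _ (fun z => z *: f (G z) + f c)).
  by move=> z; rewrite EF fD fZ.
by apply: poly_map_add (poly_map_const _); apply/poly_map_scale/IHn.
Qed.

Lemma poly_map_bilin (U V W : lmodType K) (f : U -> V -> W) (F : K -> U) (G : K -> V) :
  (forall x y a, f (x + y) a = f x a + f y a) -> (forall k x a, f (k *: x) a = k *: f x a) ->
  (forall a x y, f a (x + y) = f a x + f a y) -> (forall k a x, f a (k *: x) = k *: f a x) ->
  poly_map F -> poly_map G -> poly_map (fun z => f (F z) (G z)).
Proof.
move=> fDl fZl fDr fZr [n Fn] PG; elim: n F Fn => [|n IHn] F.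
  by move=> F0; exists 0%N => z; rewrite F0 -(scale0r 0) fZl scale0r.
case=> H [c [HH EF]].
apply: (@poly_map_ext _ _ (fun z => z *: f (H z) (G z) + f c (G z))).
  by move=> z; rewrite EF fDl fZl.
apply: poly_map_add; first by apply/poly_map_scale/IHn.
exact: poly_map_lin.
Qed.

(** Induction on the degree bound: [F] vanishes at a non-root [r] of [q], so it is [(z - r) *: G z],
    and [G] has a smaller bound and vanishes off the roots of [q * ('X - r%:P)]. The first
    hypothesis says that [K] is infinite. *)
Lemma poly_map_eq0 (V : lmodType K) (F : K -> V) (q : {poly K}) :
  (forall p : {poly K}, p != 0 -> exists r, ~~ root p r) ->
  poly_map F -> q != 0 -> (forall z, ~~ root q z -> F z = 0) -> forall z, F z = 0.
Proof.
move=> nonroot [n Fn]; elim: n F q Fn => [//|n IHn] F q Fn q0 Fq.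
have [r qr] := nonroot q q0.
have [G HG EF] := poly_lt_divX r Fn.
have Er : F r = 0 by exact: Fq.
suff G0 : forall z, G z = 0 by move=> z; rewrite EF Er G0 scaler0 addr0.
apply: (IHn G (q * ('X - r%:P))) => //.
  by rewrite mulf_neq0 ?polyXsubC_eq0.
move=> z; rewrite rootM negb_or root_XsubC => /andP[qz nz].
have /eqP := EF z; rewrite Er add0r Fq // eq_sym scaler_eq0 subr_eq0 (negbTE nz).
by move/eqP.
Qed.
End PolynomialMaps.

(** The relations [B_relations] over an arbitrary field; at [CC] the two are convertible. *)
Definition skein_relations (K : fieldType) (C : catData K) (al be ka ka' : K) : Prop :=
  let th := al * be * ka * ka' in
  compo C (br C [:: oX] [:: oX]) (br C [:: oX] [:: oX])
    = - (al * be) *: idm C [:: oX; oX] + (al + be) *: br C [:: oX] [:: oX] /\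
  compo C (br C [:: oX] [:: oXd]) (coev_Xd C) = ka *: coev_dX C /\
  compo C (br C [:: oXd] [:: oX]) (coev_dX C) = ka' *: coev_Xd C /\
  compo C (ev_Xd C) (coev_Xd C) = ((th + 1) / (ka' * (al + be))) *: idm C [::] /\
  compo C (ev_dX C) (coev_dX C) = ((th + 1) / (ka * (al + be))) *: idm C [::].

(** * Diagrams in a strict braided category with duals *)

Section Diagrams.
Variables (K : fieldType) (C : catData K).

Local Notation "f \c g" := (compo C f g) (at level 35, right associativity).
Local Notation "1_ A" := (idm C A) (at level 8, A at level 8).

(* Words are always peeled from the left and every elementary morphism is followed
   by the identity of an arbitrary word [R], so that no associativity cast occurs. *)
Definition sh (a : bool) A B (f : Hom C A B) : Hom C (a :: A) (a :: B) :=
  tens C (idm C [:: a]) f.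
Definition at2 a b c d (f : Hom C [:: a; b] [:: c; d]) R :
  Hom C (a :: b :: R) (c :: d :: R) := tens C f (idm C R).
Definition cap a b (f : Hom C [:: a; b] [::]) R : Hom C (a :: b :: R) R :=
  tens C f (idm C R).
Definition cup a b (f : Hom C [::] [:: a; b]) R : Hom C R (a :: b :: R) :=
  tens C f (idm C R).
Definition xing a b R := at2 (br C [:: a] [:: b]) R.
Definition xingV a b R := at2 (brinv C [:: a] [:: b]) R.

(** Equality of words is decidable, so proofs of [A = A] are unique and the transport is trivial. *)
Lemma castH_id A B (f : Hom C A B) : castH C f = f :> Hom C A B.
Proof.
rewrite /castH; case: eqP => // eA; case: eqP => // eB.
by rewrite (eq_axiomK eA) (eq_axiomK eB).
Qed.

Lemma castH_neq A B A' B' (f : Hom C A B) : B != B' -> castH C f = 0 :> Hom C A' B'.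
Proof. by rewrite /castH => /eqP nB; case: eqP => // eA; case: eqP. Qed.

Hypothesis HC : braided_dual_cat C.

Lemma comp_lin_l A B D (a : K) (f g : Hom C B D) (h : Hom C A B) :
  (a *: f + g) \c h = a *: (f \c h) + g \c h.
Proof. by case: HC => H _; apply: H. Qed.

Lemma comp_lin_r A B D (a : K) (f : Hom C B D) (g h : Hom C A B) :
  f \c (a *: g + h) = a *: (f \c g) + f \c h.
Proof. by case: HC => _ [H _]; apply: H. Qed.

Lemma compoA A B D E (f : Hom C D E) (g : Hom C B D) (h : Hom C A B) :
  f \c g \c h = (f \c g) \c h.
Proof. by case: HC => _ [_ [H _]]; apply: H. Qed.

Lemma comp1l A B (f : Hom C A B) : 1_ B \c f = f.
Proof. by case: HC => _ [_ [_ [H _]]]; apply: H. Qed.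

Lemma comp1r A B (f : Hom C A B) : f \c 1_ A = f.
Proof. by case: HC => _ [_ [_ [_ [H _]]]]; apply: H. Qed.

Lemma tens_lin_l A B A' B' (a : K) (f g : Hom C A B) (h : Hom C A' B') :
  tens C (a *: f + g) h = a *: tens C f h + tens C g h.
Proof. by case: HC => _ [_ [_ [_ [_ [H _]]]]]; apply: H. Qed.

Lemma tens_lin_r A B A' B' (a : K) (f : Hom C A B) (g h : Hom C A' B') :
  tens C f (a *: g + h) = a *: tens C f g + tens C f h.
Proof. by case: HC => _ [_ [_ [_ [_ [_ [H _]]]]]]; apply: H. Qed.

Lemma tens_comp A B D A' B' D' (f : Hom C B D) (g : Hom C A B)
    (f' : Hom C B' D') (g' : Hom C A' B') :
  tens C (f \c g) (f' \c g') = tens C f f' \c tens C g g'.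
Proof. by case: HC => _ [_ [_ [_ [_ [_ [_ [H _]]]]]]]; apply: H. Qed.

Lemma tens_id A B : tens C (1_ A) (1_ B) = 1_ (A ++ B).
Proof. by case: HC => _ [_ [_ [_ [_ [_ [_ [_ [H _]]]]]]]]; apply: H. Qed.

Lemma tensA A1 B1 A2 B2 A3 B3 (f1 : Hom C A1 B1) (f2 : Hom C A2 B2) (f3 : Hom C A3 B3) :
  castH C (tens C (tens C f1 f2) f3) = tens C f1 (tens C f2 f3).
Proof. by case: HC => _ [_ [_ [_ [_ [_ [_ [_ [_ [H _]]]]]]]]]; apply: H. Qed.

Lemma tens1l A B (f : Hom C A B) : tens C (1_ [::]) f = f.
Proof. by case: HC => _ [_ [_ [_ [_ [_ [_ [_ [_ [_ [H _]]]]]]]]]]; apply: H. Qed.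

Lemma tens1r A B (f : Hom C A B) : castH C (tens C f (1_ [::])) = f.
Proof. by case: HC => _ [_ [_ [_ [_ [_ [_ [_ [_ [_ [_ [H _]]]]]]]]]]]; apply: H. Qed.

Lemma br_nat A B A' B' (f : Hom C A B) (g : Hom C A' B') :
  br C B B' \c tens C f g = tens C g f \c br C A A'.
Proof. by case: HC => _ [_ [_ [_ [_ [_ [_ [_ [_ [_ [_ [_ [H _]]]]]]]]]]]]; apply: H. Qed.

Lemma brVK A B : brinv C A B \c br C A B = 1_ (A ++ B).
Proof. by case: HC => _ [_ [_ [_ [_ [_ [_ [_ [_ [_ [_ [_ [_ [H _]]]]]]]]]]]]]; apply: H. Qed.

Lemma brKV A B : br C A B \c brinv C A B = 1_ (B ++ A).
Proof. by case: HC => _ [_ [_ [_ [_ [_ [_ [_ [_ [_ [_ [_ [_ [_ [H _]]]]]]]]]]]]]]; apply: H. Qed.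

Lemma hexagon_r A B D :
      br C A (B ++ D) =
      castH C (compo C (tens C (idm C B) (br C A D))
                      (castH C (tens C (br C A B) (idm C D)) : Hom C (A ++ (B ++ D)) (B ++ (A ++ D)))).
Proof. by case: HC => _ [_ [_ [_ [_ [_ [_ [_ [_ [_ [_ [_ [_ [_ [_ [H _]]]]]]]]]]]]]]]; apply: H. Qed.

Lemma hexagon_l A B D :
      br C (A ++ B) D =
      castH C (compo C (tens C (br C A D) (idm C B))
                      (castH C (tens C (idm C A) (br C B D)) : Hom C ((A ++ B) ++ D) ((A ++ D) ++ B))).
Proof. by case: HC => _ [_ [_ [_ [_ [_ [_ [_ [_ [_ [_ [_ [_ [_ [_ [_ [H _]]]]]]]]]]]]]]]]; apply: H. Qed.

(** * Bilinearity and the interchange law *)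

Lemma comp0l A B D (h : Hom C A B) : (0 : Hom C B D) \c h = 0.
Proof.
have := comp_lin_l (-1) (0 : Hom C B D) 0 h.
by rewrite scaler0 add0r scaleN1r addNr.
Qed.

Lemma comp0r A B D (h : Hom C B D) : h \c (0 : Hom C A B) = 0.
Proof.
have := comp_lin_r (-1) h (0 : Hom C A B) 0.
by rewrite scaler0 add0r scaleN1r addNr.
Qed.

Lemma compDl A B D (f g : Hom C B D) (h : Hom C A B) : (f + g) \c h = f \c h + g \c h.
Proof. by have := comp_lin_l 1 f g h; rewrite !scale1r. Qed.

Lemma compDr A B D (f : Hom C B D) (g h : Hom C A B) : f \c (g + h) = f \c g + f \c h.
Proof. by have := comp_lin_r 1 f g h; rewrite !scale1r. Qed.

Lemma compZl A B D a (f : Hom C B D) (h : Hom C A B) : (a *: f) \c h = a *: (f \c h).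
Proof. by have := comp_lin_l a f 0 h; rewrite comp0l !addr0. Qed.

Lemma compZr A B D a (f : Hom C B D) (h : Hom C A B) : f \c (a *: h) = a *: (f \c h).
Proof. by have := comp_lin_r a f h 0; rewrite comp0r !addr0. Qed.

Lemma compNl A B D (f : Hom C B D) (h : Hom C A B) : (- f) \c h = - (f \c h).
Proof. by rewrite -scaleN1r compZl scaleN1r. Qed.

Lemma compNr A B D (f : Hom C B D) (h : Hom C A B) : f \c (- h) = - (f \c h).
Proof. by rewrite -scaleN1r compZr scaleN1r. Qed.

Definition bilin := (compDl, compDr, compNl, compNr, compZl, compZr).

Lemma tens0l A B A' B' (h : Hom C A' B') : tens C (0 : Hom C A B) h = 0.
Proof.
have := tens_lin_l (-1) (0 : Hom C A B) 0 h.
by rewrite scaler0 add0r scaleN1r addNr.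
Qed.

Lemma tens0r A B A' B' (h : Hom C A B) : tens C h (0 : Hom C A' B') = 0.
Proof.
have := tens_lin_r (-1) h (0 : Hom C A' B') 0.
by rewrite scaler0 add0r scaleN1r addNr.
Qed.

Lemma shD a A B (f g : Hom C A B) : sh a (f + g) = sh a f + sh a g.
Proof. by have := tens_lin_r 1 (1_ [:: a]) f g; rewrite !scale1r. Qed.

Lemma sh0 a A B : sh a (0 : Hom C A B) = 0.
Proof. by rewrite /sh tens0r. Qed.

Lemma shZ a A B x (f : Hom C A B) : sh a (x *: f) = x *: sh a f.
Proof. by have := tens_lin_r x (1_ [:: a]) f 0; rewrite tens0r !addr0. Qed.

Lemma shN a A B (f : Hom C A B) : sh a (- f) = - sh a f.
Proof. by rewrite -scaleN1r shZ scaleN1r. Qed.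

Lemma sh_comp a A B D (f : Hom C B D) (g : Hom C A B) : sh a (f \c g) = sh a f \c sh a g.
Proof. by have := tens_comp (1_ [:: a]) (1_ [:: a]) f g; rewrite comp1l. Qed.

Lemma sh1 a A : sh a (1_ A) = 1_ (a :: A).
Proof. exact: (tens_id [:: a] A). Qed.

Lemma at2D a b c d (f g : Hom C [:: a; b] [:: c; d]) R : at2 (f + g) R = at2 f R + at2 g R.
Proof. by have := tens_lin_l 1 f g (1_ R); rewrite !scale1r. Qed.

Lemma at2Z a b c d x (f : Hom C [:: a; b] [:: c; d]) R : at2 (x *: f) R = x *: at2 f R.
Proof. by have := tens_lin_l x f 0 (1_ R); rewrite tens0l !addr0. Qed.

Lemma at2N a b c d (f : Hom C [:: a; b] [:: c; d]) R : at2 (- f) R = - at2 f R.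
Proof. by rewrite -scaleN1r at2Z scaleN1r. Qed.

Lemma at2_comp a b c d e e' (f : Hom C [:: c; d] [:: e; e']) (g : Hom C [:: a; b] [:: c; d]) R :
  at2 (f \c g) R = at2 f R \c at2 g R.
Proof. by have := tens_comp f g (1_ R) (1_ R); rewrite comp1l. Qed.

Lemma at2_1 a b R : at2 (1_ [:: a; b]) R = 1_ (a :: b :: R).
Proof. exact: (tens_id [:: a; b] R). Qed.

Lemma at2_cup_cap a b c d (f : Hom C [:: a; b] [::]) (g : Hom C [::] [:: c; d]) R :
  at2 (g \c f) R = cup g R \c cap f R.
Proof. by have := tens_comp g f (1_ R) (1_ R); rewrite comp1l. Qed.

Lemma sh2E a b A B (f : Hom C A B) : sh a (sh b f) = tens C (1_ [:: a; b]) f.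
Proof.
have := tensA (1_ [:: a]) (1_ [:: b]) f; rewrite castH_id tens_id => E.
exact: (esym E).
Qed.

(** Both sides are [tens C f g] by the interchange law: morphisms on disjoint strands commute. *)
Lemma at2_sh a b c d (f : Hom C [:: a; b] [:: c; d]) P Q (g : Hom C P Q) :
  at2 f Q \c sh a (sh b g) = sh c (sh d g) \c at2 f P.
Proof.
rewrite !sh2E.
have := tens_comp f (1_ _) (1_ Q) g; have := tens_comp (1_ _) f g (1_ P).
by rewrite !comp1l !comp1r => -> /esym.
Qed.

Lemma cap_sh a b (f : Hom C [:: a; b] [::]) P Q (g : Hom C P Q) :
  cap f Q \c sh a (sh b g) = g \c cap f P.
Proof.
rewrite !sh2E.
have := tens_comp f (1_ _) (1_ Q) g; have := tens_comp (1_ _) f g (1_ P).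
by rewrite !comp1l !comp1r tens1l => -> /esym.
Qed.

Lemma cup_sh a b (f : Hom C [::] [:: a; b]) P Q (g : Hom C P Q) :
  sh a (sh b g) \c cup f P = cup f Q \c g.
Proof.
rewrite !sh2E.
have := tens_comp f (1_ _) (1_ Q) g; have := tens_comp (1_ _) f g (1_ P).
by rewrite !comp1l !comp1r tens1l => -> /esym.
Qed.

Lemma xingVK a b R : xingV a b R \c xing a b R = 1_ (a :: b :: R).
Proof. by have := at2_comp (brinv C [:: a] [:: b]) (br C [:: a] [:: b]) R;
  rewrite (brVK [:: a]) at2_1. Qed.

Lemma xingKV a b R : xing a b R \c xingV a b R = 1_ (b :: a :: R).
Proof. by have := at2_comp (br C [:: a] [:: b]) (brinv C [:: a] [:: b]) R;
  rewrite (brKV [:: a] [:: b]) at2_1. Qed.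

Lemma tens1_comp A B D (f : Hom C B D) (g : Hom C A B) R :
  tens C (f \c g) (1_ R) = tens C f (1_ R) \c tens C g (1_ R).
Proof. by have := tens_comp f g (1_ R) (1_ R); rewrite comp1l. Qed.

Lemma sh_tens1 a A B (f : Hom C A B) R : tens C (sh a f) (1_ R) = sh a (tens C f (1_ R)).
Proof. by have := tensA (1_ [:: a]) f (1_ R); rewrite castH_id. Qed.

Lemma sh_tens1_at2 x a b c d (f : Hom C [:: a; b] [:: c; d]) R :
  tens C (sh x f) (1_ R) = sh x (at2 f R).
Proof. exact: sh_tens1. Qed.

Lemma tens1_at2 a b c d (f : Hom C [:: a; b] [:: c; d]) e R :
  tens C (tens C f (1_ [:: e])) (1_ R) = at2 f (e :: R).
Proof.
by have := tensA f (1_ [:: e]) (1_ R); rewrite castH_id tens_id.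
Qed.

Lemma tens1_cap a b (f : Hom C [:: a; b] [::]) e R :
  tens C (tens C f (1_ [:: e])) (1_ R) = cap f (e :: R).
Proof.
by have := tensA f (1_ [:: e]) (1_ R); rewrite castH_id tens_id.
Qed.

Lemma tens1_cup a b (f : Hom C [::] [:: a; b]) e R :
  tens C (tens C f (1_ [:: e])) (1_ R) = cup f (e :: R).
Proof.
by have := tensA f (1_ [:: e]) (1_ R); rewrite castH_id tens_id.
Qed.

Lemma zigzag_X_r R : sh oX (cap (ev_dX C) R) \c cup (coev_Xd C) (oX :: R) = 1_ (oX :: R).
Proof.
case: HC => _ [_ [_ [_ [_ [_ [_ [_ [_ [_ [_ [_ [_ [_ [_ [_ [_ [H _]]]]]]]]]]]]]]]]].
have := tens_comp (tens C (1_ [:: oX]) (ev_dX C)) (tens C (coev_Xd C) (1_ [:: oX])) (1_ R) (1_ R).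
rewrite comp1l H (tens_id [:: oX] R) => ->.
by rewrite sh_tens1 tens1_cup.
Qed.

Lemma zigzag_Xd_r R : cap (ev_dX C) (oXd :: R) \c sh oXd (cup (coev_Xd C) R) = 1_ (oXd :: R).
Proof.
case: HC => _ [_ [_ [_ [_ [_ [_ [_ [_ [_ [_ [_ [_ [_ [_ [_ [_ [_ [H _]]]]]]]]]]]]]]]]]].
have := tens_comp (tens C (ev_dX C) (1_ [:: oXd])) (tens C (1_ [:: oXd]) (coev_Xd C)) (1_ R) (1_ R).
rewrite comp1l H (tens_id [:: oXd] R) => ->.
by rewrite sh_tens1 tens1_cap.
Qed.

Lemma zigzag_X_l R : cap (ev_Xd C) (oX :: R) \c sh oX (cup (coev_dX C) R) = 1_ (oX :: R).
Proof.
case: HC => _ [_ [_ [_ [_ [_ [_ [_ [_ [_ [_ [_ [_ [_ [_ [_ [_ [_ [_ [H _]]]]]]]]]]]]]]]]]]].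
have := tens_comp (tens C (ev_Xd C) (1_ [:: oX])) (tens C (1_ [:: oX]) (coev_dX C)) (1_ R) (1_ R).
rewrite comp1l H (tens_id [:: oX] R) => ->.
by rewrite sh_tens1 tens1_cap.
Qed.

Lemma zigzag_Xd_l R : sh oXd (cap (ev_Xd C) R) \c cup (coev_dX C) (oXd :: R) = 1_ (oXd :: R).
Proof.
case: HC => _ [_ [_ [_ [_ [_ [_ [_ [_ [_ [_ [_ [_ [_ [_ [_ [_ [_ [_ [_ H]]]]]]]]]]]]]]]]]]].
have := tens_comp (tens C (1_ [:: oXd]) (ev_Xd C)) (tens C (coev_dX C) (1_ [:: oXd])) (1_ R) (1_ R).
rewrite comp1l H (tens_id [:: oXd] R) => ->.
by rewrite sh_tens1 tens1_cup.
Qed.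

(** * Naturality of the braiding: braid relation and slides *)

Lemma brE_r a b d : br C [:: a] [:: b; d] = sh b (br C [:: a] [:: d]) \c
  (tens C (br C [:: a] [:: b]) (1_ [:: d]) : Hom C [:: a; b; d] [:: b; a; d]).
Proof. by have := hexagon_r [:: a] [:: b] [:: d]; rewrite !castH_id. Qed.

Lemma brE_l a b d : br C [:: a; b] [:: d] =
  (tens C (br C [:: a] [:: d]) (1_ [:: b]) : Hom C [:: a; d; b] [:: d; a; b])
  \c sh a (br C [:: b] [:: d]).
Proof. by have := hexagon_l [:: a] [:: b] [:: d]; rewrite !castH_id. Qed.

(** The hexagon at empty words makes this braiding idempotent, and it is invertible. *)
Lemma br_unit_r a : br C [:: a] [::] = 1_ [:: a].
Proof.
have := hexagon_r [:: a] [::] [::]; rewrite tens1l !castH_id.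
have := tens1r (br C [:: a] [::]); rewrite castH_id => -> E.
have := congr1 (fun f => brinv C [:: a] [::] \c f) E.
by rewrite compoA brVK comp1l.
Qed.

Lemma br_unit_l a : br C [::] [:: a] = 1_ [:: a].
Proof.
have := hexagon_l [::] [::] [:: a]; rewrite tens1l !castH_id.
have := tens1r (br C [::] [:: a]); rewrite castH_id => -> E.
have := congr1 (fun f => brinv C [::] [:: a] \c f) E.
by rewrite compoA brVK comp1l.
Qed.

(** Naturality of the braiding past the strand [d], applied to the crossing of [a] and [b] and
    expanded by the hexagon. *)
Lemma braid a b d R :
  sh d (xing a b R) \c xing a d (b :: R) \c sh a (xing b d R) =
  xing b d (a :: R) \c sh b (xing a d R) \c xing a b (d :: R).
Proof.
have := br_nat (br C [:: a] [:: b]) (1_ [:: d]).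
rewrite [br C ([:: b] ++ _) _]brE_l [br C ([:: a] ++ _) _]brE_l.
move/(congr1 (fun f => tens C f (1_ R))).
by rewrite !tens1_comp !tens1_at2 !sh_tens1_at2 -!compoA => <-.
Qed.

(** Naturality at a cap: its target is empty, so the braiding on that side is the identity by
    [br_unit_r]. *)
Lemma sh_cap_slide a p q (f : Hom C [:: p; q] [::]) R :
  sh a (cap f R) = cap f (a :: R) \c sh p (xing a q R) \c xing a p (q :: R).
Proof.
have := br_nat (1_ [:: a]) f; rewrite br_unit_r comp1l brE_r.
move/(congr1 (fun g => tens C g (1_ R))).
by rewrite !tens1_comp tens1_cap tens1_at2 sh_tens1_at2 sh_tens1.
Qed.

Lemma cap_slide a p q (f : Hom C [:: p; q] [::]) R :
  cap f (a :: R) = sh a (cap f R) \c xing p a (q :: R) \c sh p (xing q a R).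
Proof.
have := br_nat f (1_ [:: a]); rewrite br_unit_l comp1l brE_l.
move/(congr1 (fun g => tens C g (1_ R))).
by rewrite !tens1_comp tens1_cap tens1_at2 sh_tens1_at2 sh_tens1.
Qed.

Lemma cup_slide a p q (f : Hom C [::] [:: p; q]) R :
  cup f (a :: R) = sh p (xing a q R) \c xing a p (q :: R) \c sh a (cup f R).
Proof.
have := br_nat (1_ [:: a]) f; rewrite br_unit_r comp1r brE_r -compoA => /esym.
move/(congr1 (fun g => tens C g (1_ R))).
by rewrite !tens1_comp tens1_cup tens1_at2 sh_tens1_at2 sh_tens1.
Qed.

Lemma sh_cup_slide a p q (f : Hom C [::] [:: p; q]) R :
  sh a (cup f R) = xing p a (q :: R) \c sh p (xing q a R) \c cup f (a :: R).
Proof.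
have := br_nat f (1_ [:: a]); rewrite br_unit_l comp1r brE_l -compoA => /esym.
move/(congr1 (fun g => tens C g (1_ R))).
by rewrite !tens1_comp tens1_cup tens1_at2 sh_tens1_at2 sh_tens1.
Qed.

Lemma at2_cup a b c d (f : Hom C [:: a; b] [:: c; d]) (g : Hom C [::] [:: a; b]) R :
  at2 f R \c cup g R = cup (f \c g) R.
Proof. by have := tens1_comp f g R. Qed.

Lemma cupZ a b x (f : Hom C [::] [:: a; b]) R : cup (x *: f) R = x *: cup f R.
Proof. by have := tens_lin_l x f 0 (1_ R); rewrite tens0l !addr0. Qed.

Lemma xingKVl a b R A (f : Hom C A _) : xing a b R \c xingV a b R \c f = f.
Proof. by rewrite compoA xingKV comp1l. Qed.

Lemma xingVKl a b R A (f : Hom C A _) : xingV a b R \c xing a b R \c f = f.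
Proof. by rewrite compoA xingVK comp1l. Qed.

Lemma comp_xing_inj a b R A (f g : Hom C _ A) :
  f \c xing a b R = g \c xing a b R -> f = g.
Proof.
move/(congr1 (fun h => h \c xingV a b R)).
by rewrite -!compoA xingKV !comp1r.
Qed.

Lemma xing_comp_inj a b R A (f g : Hom C A _) :
  xing a b R \c f = xing a b R \c g -> f = g.
Proof. by move/(congr1 (fun h => xingV a b R \c h)); rewrite !xingVKl. Qed.

Lemma sh_xing_inj x a b R A (f g : Hom C _ A) :
  f \c sh x (xing a b R) = g \c sh x (xing a b R) -> f = g.
Proof.
move/(congr1 (fun h => h \c sh x (xingV a b R))).
by rewrite -!compoA -!sh_comp xingKV !sh1 !comp1r.
Qed.

Lemma sh_xing_comp_inj x a b R A (f g : Hom C A _) :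
  sh x (xing a b R) \c f = sh x (xing a b R) \c g -> f = g.
Proof.
move/(congr1 (fun h => sh x (xingV a b R) \c h)).
by rewrite !compoA -!sh_comp xingVK !sh1 !comp1l.
Qed.

(** Cancelling one crossing in [sh_cap_slide] trades a crossing with one leg of the cap for the
    inverse crossing with the other leg. These four variants change the orientation of strands in
    all that follows. *)
Lemma cap_xingV_slide a p q (f : Hom C [:: p; q] [::]) R :
  sh a (cap f R) \c xingV a p (q :: R) = cap f (a :: R) \c sh p (xing a q R).
Proof. by apply: comp_xing_inj; rewrite -!compoA xingVK comp1r sh_cap_slide. Qed.

Lemma cap_xing_slide a p q (f : Hom C [:: p; q] [::]) R :
  sh a (cap f R) \c xing p a (q :: R) = cap f (a :: R) \c sh p (xingV q a R).
Proof.
by apply: (@sh_xing_inj p q a); rewrite -!compoA -sh_comp xingVK sh1 comp1r -cap_slide.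
Qed.

Lemma xing_cup_slide a p q (f : Hom C [::] [:: p; q]) R :
  xing a p (q :: R) \c sh a (cup f R) = sh p (xingV a q R) \c cup f (a :: R).
Proof.
by apply: (@sh_xing_comp_inj p a q); rewrite -cup_slide [RHS]compoA -sh_comp xingKV sh1 comp1l.
Qed.

Lemma xingV_cup_slide a p q (f : Hom C [::] [:: p; q]) R :
  xingV p a (q :: R) \c sh a (cup f R) = sh p (xing q a R) \c cup f (a :: R).
Proof. by apply: (@xing_comp_inj p a); rewrite xingKVl sh_cup_slide. Qed.

(** Bending the last output down with a cap loses nothing, since a cup on the right restores it by a
    zigzag. *)
Lemma tail_bend_inj a b (f g : Hom C [:: a; b] [:: oX; oXd]) R :
  (forall R', sh oX (cap (ev_dX C) R') \c at2 f (oX :: R') =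
              sh oX (cap (ev_dX C) R') \c at2 g (oX :: R')) ->
  at2 f R = at2 g R.
Proof.
move=> E.
have U (h : Hom C [:: a; b] [:: oX; oXd]) : at2 h R =
    (sh oX (cap (ev_dX C) (oXd :: R)) \c at2 h (oX :: oXd :: R))
      \c sh a (sh b (cup (coev_Xd C) R)).
  by rewrite -compoA at2_sh compoA -sh_comp zigzag_Xd_r sh1 comp1l.
by rewrite (U f) E -U.
Qed.

(** The same principle for the first output, which a cup on the left restores. *)
Lemma head_bend_inj A B (f g : Hom C A (oXd :: B)) :
  cap (ev_Xd C) B \c sh oX f = cap (ev_Xd C) B \c sh oX g -> f = g.
Proof.
move=> E.
have U (h : Hom C A (oXd :: B)) :
    h = sh oXd (cap (ev_Xd C) B \c sh oX h) \c cup (coev_dX C) A.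
  by rewrite sh_comp -compoA cup_sh compoA zigzag_Xd_l comp1l.
by rewrite (U f) E -U.
Qed.

(** * Skein relations for all orientations of the strands *)

Variables (al be ka ka' : K).
Hypothesis HP : [/\ al != 0, be != 0, al + be != 0, ka != 0 & ka' != 0].
Hypothesis HB : skein_relations C al be ka ka'.
Local Notation th := (al * be * ka * ka').

Lemma albe_neq0 : al * be != 0.
Proof. by case: HP => al0 be0 _ _ _; rewrite mulf_neq0. Qed.
Lemma ka_neq0 : ka != 0. Proof. by case: HP. Qed.
Lemma ka'_neq0 : ka' != 0. Proof. by case: HP. Qed.

Lemma xing_coev_Xd R : xing oX oXd R \c cup (coev_Xd C) R = ka *: cup (coev_dX C) R.
Proof. by case: HB => _ [H _]; rewrite at2_cup H cupZ. Qed.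

Lemma xing_coev_dX R : xing oXd oX R \c cup (coev_dX C) R = ka' *: cup (coev_Xd C) R.
Proof. by case: HB => _ [_ [H _]]; rewrite at2_cup H cupZ. Qed.

Lemma cap_cup a b (f : Hom C [:: a; b] [::]) (g : Hom C [::] [:: a; b]) x R :
  f \c g = x *: 1_ [::] -> cap f R \c cup g R = x *: 1_ R.
Proof.
move=> H; have := tens1_comp f g R; rewrite H.
have := tens_lin_l x (1_ [::]) 0 (1_ R).
by rewrite tens0l !addr0 tens1l => ->.
Qed.

Lemma loop_Xd R : cap (ev_Xd C) R \c cup (coev_Xd C) R = ((th + 1) / (ka' * (al + be))) *: 1_ R.
Proof. by apply: cap_cup; case: HB => _ [_ [_ [H _]]]. Qed.

Lemma loop_dX R : cap (ev_dX C) R \c cup (coev_dX C) R = ((th + 1) / (ka * (al + be))) *: 1_ R.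
Proof. by apply: cap_cup; case: HB => _ [_ [_ [_ H]]]. Qed.

Lemma xing_X_sqr R : xing oX oX R \c xing oX oX R =
  - (al * be) *: 1_ (oX :: oX :: R) + (al + be) *: xing oX oX R.
Proof.
case: HB => H _; rewrite -at2_1 -!at2Z -at2D -[X in at2 X _]H.
by have := at2_comp (br C [:: oX] [:: oX]) (br C [:: oX] [:: oX]) R.
Qed.

Lemma xing_X_skein R : xing oX oX R = (al + be) *: 1_ _ - (al * be) *: xingV oX oX R.
Proof.
have := congr1 (fun h => xingV oX oX R \c h) (xing_X_sqr R).
rewrite xingVKl !bilin comp1r xingVK => ->.
by rewrite scaleNr addrC.
Qed.

(** A rotated form of the Hecke relation: bending the output [oXd] turns both sides into those of
    [xing_X_skein]. *)
Lemma xingV_XXd R : xingV oX oXd R =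
  (al + be) *: (cup (coev_Xd C) R \c cap (ev_dX C) R) - (al * be) *: xing oXd oX R.
Proof.
have E R' : (al + be) *: (cup (coev_Xd C) R' \c cap (ev_dX C) R') - (al * be) *: xing oXd oX R'
  = at2 ((al + be) *: (coev_Xd C \c ev_dX C) - (al * be) *: br C [:: oXd] [:: oX]) R'.
  by rewrite at2D at2N !at2Z at2_cup_cap.
rewrite E /xingV; apply: tail_bend_inj => R'; rewrite -E -/(xingV _ _ _) !bilin.
rewrite cap_xing_slide cap_xingV_slide compoA zigzag_X_r comp1l xing_X_skein.
by rewrite shD shN !shZ sh1 !bilin comp1r.
Qed.

(** The twist relation, given for coevaluations, passes to evaluations by duality. The curl computed
    in [E] is the scalar [ka']. *)
Lemma ev_dX_xing R : cap (ev_dX C) R \c xing oX oXd R = ka' *: cap (ev_Xd C) R.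
Proof.
have E R' : cap (ev_dX C) (oX :: R') \c xing oX oXd (oX :: R') \c sh oX (cup (coev_dX C) R')
    = ka' *: 1_ (oX :: R').
  rewrite xing_cup_slide compoA -cap_xing_slide -compoA xing_coev_dX !bilin.
  by rewrite zigzag_X_r.
(* Capping the curl with [ev_Xd] and moving this cap below the crossing creates a zigzag, which
   straightens to the claim. *)
have := congr1 (fun h => cap (ev_Xd C) R \c h) (E (oXd :: R)).
rewrite !bilin comp1r => <-.
rewrite compoA -cap_sh -compoA; congr (_ \c _).
by rewrite compoA -at2_sh -compoA -sh_comp zigzag_Xd_l sh1 comp1r.
Qed.

Lemma ev_Xd_xing R : cap (ev_Xd C) R \c xing oXd oX R = ka *: cap (ev_dX C) R.
Proof.
have E R' : cap (ev_Xd C) (oXd :: R') \c xing oXd oX (oXd :: R') \c sh oXd (cup (coev_Xd C) R')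
    = ka *: 1_ (oXd :: R').
  rewrite xing_cup_slide compoA -cap_xing_slide -compoA xing_coev_Xd !bilin.
  by rewrite zigzag_Xd_l.
have := congr1 (fun h => cap (ev_dX C) R \c h) (E (oX :: R)).
rewrite !bilin comp1r => <-.
rewrite compoA -cap_sh -compoA; congr (_ \c _).
by rewrite compoA -at2_sh -compoA -sh_comp zigzag_X_r sh1 comp1r.
Qed.

Lemma xingV_cup_Xd R : xingV oXd oX R \c cup (coev_Xd C) R = ka'^-1 *: cup (coev_dX C) R.
Proof.
apply: xing_comp_inj; rewrite xingKVl !bilin xing_coev_dX scalerA mulVf ?ka_neq0 ?ka'_neq0 //.
by rewrite scale1r.
Qed.

Lemma ev_dX_xingV R : cap (ev_dX C) R \c xingV oXd oX R = ka^-1 *: cap (ev_Xd C) R.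
Proof.
apply: comp_xing_inj.
rewrite -compoA xingVK comp1r !bilin ev_Xd_xing scalerA mulVf ?ka_neq0 ?ka'_neq0 //.
by rewrite scale1r.
Qed.

Lemma xing_XdX_XXd R : (al * be) *: (xing oXd oX R \c xing oX oXd R) =
  ((al + be) * ka') *: (cup (coev_Xd C) R \c cap (ev_Xd C) R) - 1_ _.
Proof.
have := congr1 (fun h => h \c xing oX oXd R) (xingV_XXd R).
rewrite xingVK !bilin -compoA ev_dX_xing !bilin scalerA => ->.
by rewrite opprB addrC subrK.
Qed.

Lemma xing_XXd_XdX R : (al * be) *: (xing oX oXd R \c xing oXd oX R) =
  ((al + be) * ka) *: (cup (coev_dX C) R \c cap (ev_dX C) R) - 1_ _.
Proof.
have := congr1 (fun h => xing oX oXd R \c h) (xingV_XXd R).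
rewrite xingKV !bilin compoA xing_coev_Xd !bilin scalerA => ->.
by rewrite opprB addrC subrK.
Qed.

Lemma xingV_XdX R : xingV oXd oX R =
  (al + be) *: (cup (coev_dX C) R \c cap (ev_Xd C) R) - (al * be) *: xing oX oXd R.
Proof.
apply: xing_comp_inj; rewrite xingKV !bilin compoA xing_coev_dX !bilin scalerA.
by rewrite xing_XdX_XXd opprB addrC subrK.
Qed.

(** A further rotation: bending the first output reduces the claim to [xingV_XdX]. *)
Lemma xing_Xd_skein R : xing oXd oXd R = (al + be) *: 1_ _ - (al * be) *: xingV oXd oXd R.
Proof.
apply: head_bend_inj; rewrite shD shN !shZ sh1 !bilin comp1r.
rewrite -cap_xing_slide -cap_xingV_slide xingV_XdX !bilin compoA zigzag_Xd_l.
by rewrite comp1l.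
Qed.

(** The left partial trace over the first strand. *)
Definition lclose A B (f : Hom C (oXd :: A) (oXd :: B)) : Hom C A B :=
  cap (ev_Xd C) B \c sh oX f \c cup (coev_Xd C) A.

(** First Reidemeister move up to framing: the slide moves the crossing onto the legs of the cup,
    where it is the scalar [ka'^-1]. *)
Lemma lclose_xing R : lclose (xing oXd oXd R) = ka'^-1 *: 1_ (oXd :: R).
Proof.
rewrite /lclose compoA -cap_xingV_slide -compoA xingV_cup_Xd !bilin.
by rewrite zigzag_Xd_l.
Qed.

Lemma curl_dX R : sh oXd (cap (ev_dX C) R) \c xing oXd oXd (oX :: R) \c sh oXd (cup (coev_dX C) R)
  = ka^-1 *: 1_ (oXd :: R).
Proof.
rewrite xing_cup_slide compoA -sh_comp ev_dX_xingV shZ !bilin.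
by rewrite zigzag_Xd_l.
Qed.

Lemma xingV_Xd R :
  xingV oXd oXd R = (al * be)^-1 *: ((al + be) *: 1_ (oXd :: oXd :: R) - xing oXd oXd R).
Proof. by rewrite xing_Xd_skein opprB addrC subrK scalerA mulVf ?albe_neq0 ?scale1r. Qed.

Lemma xing_Xd_sqr R : xing oXd oXd R \c xing oXd oXd R =
  (al + be) *: xing oXd oXd R - (al * be) *: 1_ (oXd :: oXd :: R).
Proof.
by rewrite {2}xing_Xd_skein !bilin comp1r xingKV.
Qed.

Lemma sh_xingKVl x a b R A (f : Hom C A _) :
  sh x (xing a b R) \c sh x (xingV a b R) \c f = f.
Proof. by rewrite compoA -sh_comp xingKV sh1 comp1l. Qed.

(** * Baxterized crossings and their Yang-Baxter equations *)

Variables u v : K.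
Hypothesis uv : u * v = - th.

(* [hatT] and [hatS] are [Rx] cleared of its pole: multiplied by [z - 1] for [x = X*],
   and by [z - u] (resp. [w - v]) for [x = X]. *)
Definition hatT x (z : K) : Hom C [:: oXd; x] [:: x; oXd] :=
  match x return Hom C [:: oXd; x] [:: x; oXd] with
  | true => (z - u) *: br C [:: oXd] [:: oX]
            + ((al + be) / (al * be) * u) *: (coev_Xd C \c ev_dX C)
  | false => (z - 1) *: br C [:: oXd] [:: oXd] + (al + be) *: 1_ [:: oXd; oXd]
  end.
Definition hatS x (w : K) : Hom C [:: x; oXd] [:: oXd; x] :=
  match x return Hom C [:: x; oXd] [:: oXd; x] with
  | true => (w - v) *: br C [:: oX] [:: oXd]
            + ((al + be) / (al * be) * v) *: (coev_dX C \c ev_Xd C)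
  | false => (w - 1) *: br C [:: oXd] [:: oXd] + (al + be) *: 1_ [:: oXd; oXd]
  end.
Definition crossT x z R := at2 (hatT x z) R.
Definition crossS x z R := at2 (hatS x z) R.
(* Up to the factor [z - 1] (resp. [z - w]), [crossR (z - 1) (al + be)] is the crossing
   of parameter [z] and [crossR (z - w) (w * (al + be))] that of parameter [z / w]. *)
Definition crossR (y e : K) R : Hom C (oXd :: oXd :: R) (oXd :: oXd :: R) :=
  y *: xing oXd oXd R + e *: 1_ _.

Lemma crossT_X z R : crossT oX z R = (z - u) *: xing oXd oX R
  + ((al + be) / (al * be) * u) *: (cup (coev_Xd C) R \c cap (ev_dX C) R).
Proof. by rewrite /crossT at2D !at2Z at2_cup_cap. Qed.

Lemma crossS_X z R : crossS oX z R = (z - v) *: xing oX oXd R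
  + ((al + be) / (al * be) * v) *: (cup (coev_dX C) R \c cap (ev_Xd C) R).
Proof. by rewrite /crossS at2D !at2Z at2_cup_cap. Qed.

Lemma crossT_Xd z R : crossT oXd z R = crossR (z - 1) (al + be) R.
Proof. by rewrite /crossT at2D !at2Z at2_1. Qed.

Lemma crossS_Xd z R : crossS oXd z R = crossR (z - 1) (al + be) R.
Proof. by rewrite /crossS at2D !at2Z at2_1. Qed.

Definition expand_rules := (bilin, shD, shZ, sh1, comp1l, comp1r).

(** After [braid] and the quadratic relation, the two sides can differ only in the coefficients of
    the single crossings; the hypothesis equates these. *)
Lemma crossR_braid y1 e1 y2 e2 y3 e3 R :
  y1 * e2 * y3 * (al + be) + y1 * e2 * e3 + e1 * e2 * y3 = e1 * y2 * e3 ->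
  sh oXd (crossR y1 e1 R) \c crossR y2 e2 (oXd :: R) \c sh oXd (crossR y3 e3 R) =
  crossR y3 e3 (oXd :: R) \c sh oXd (crossR y2 e2 R) \c crossR y1 e1 (oXd :: R).
Proof.
move=> cond; rewrite /crossR !expand_rules -!sh_comp !xing_Xd_sqr braid !shD !shN !shZ !sh1.
lin_coefs; try ring.
- apply/eqP; rewrite -subr_eq0; apply/eqP.
  transitivity ((y1 * e2 * y3 * (al + be) + y1 * e2 * e3 + e1 * e2 * y3) - e1 * y2 * e3).
    by ring.
  by rewrite cond subrr.
- apply/eqP; rewrite -subr_eq0; apply/eqP.
  transitivity (e1 * y2 * e3 - (y1 * e2 * y3 * (al + be) + y1 * e2 * e3 + e1 * e2 * y3)).
    by ring.
  by rewrite cond subrr.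
Qed.

Lemma xing_cup_slide_tail a p q (f : Hom C [::] [:: p; q]) R A (h : Hom C A (a :: R)) :
  xing a p (q :: R) \c sh a (cup f R) \c h = sh p (xingV a q R) \c cup f (a :: R) \c h.
Proof. by rewrite compoA xing_cup_slide -compoA. Qed.

Lemma zigzag_Xd_r_tail R A (f : Hom C A (oXd :: R)) :
  cap (ev_dX C) (oXd :: R) \c sh oXd (cup (coev_Xd C) R) \c f = f.
Proof. by rewrite compoA zigzag_Xd_r comp1l. Qed.

Lemma zigzag_Xd_l_tail R A (f : Hom C A (oXd :: R)) :
  sh oXd (cap (ev_Xd C) R) \c cup (coev_dX C) (oXd :: R) \c f = f.
Proof. by rewrite compoA zigzag_Xd_l comp1l. Qed.

(** For [x = oX], pulling strands across cups and caps and straightening zigzags leaves inverse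
    crossings of two [oXd] strands; [xingV_Xd] removes these, and coefficients can be compared. *)
Lemma braid_T x z w R :
  sh x (crossR (z - w) (w * (al + be)) R) \c crossT x z (oXd :: R) \c sh oXd (crossT x w R) =
  crossT x w (oXd :: R) \c sh oXd (crossT x z R) \c crossR (z - w) (w * (al + be)) (x :: R).
Proof.
case: x; last first.
  by rewrite !crossT_Xd; apply: crossR_braid; ring.
change true with oX.
rewrite !crossT_X /crossR.
have E2 : cap (ev_dX C) (oXd :: R) \c sh oXd (xing oXd oX R) =
  sh oXd (cap (ev_dX C) R) \c xingV oXd oXd (oX :: R).
  by rewrite cap_xingV_slide.
rewrite !(expand_rules, sh_comp) -!compoA.
rewrite !xing_cup_slide_tail !zigzag_Xd_r_tail.
rewrite ![cap _ _ \c sh oXd (xing _ _ _) \c _]compoA !E2 -!compoA.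
rewrite !sh_xingKVl !xingVK !comp1r -braid !xingV_Xd !expand_rules !shN !expand_rules.
lin_coefs; field; case: HP => al0 be0 _ _ _; by rewrite al0 be0.
Qed.

(** The counterpart for returning strands. The factor [c], later [rho], is harmless because the
    first crossing depends only on the ratio of the parameters, up to scaling. *)
Lemma braid_S x z w (c : K) R :
  crossR (z - w) (w * (al + be)) (x :: R) \c
    sh oXd (crossS x (c * z) R) \c crossS x (c * w) (oXd :: R) =
  sh oXd (crossS x (c * w) R) \c crossS x (c * z) (oXd :: R) \c
    sh x (crossR (z - w) (w * (al + be)) R).
Proof.
case: x; last first.
  by rewrite !crossS_Xd -crossR_braid //; ring.
change true with oX.
rewrite !crossS_X /crossR.
have E1 : sh oXd (xing oX oXd R) \c cup (coev_dX C) (oXd :: R) =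
  xingV oXd oXd (oX :: R) \c sh oXd (cup (coev_dX C) R).
  by rewrite xingV_cup_slide.
have E2 : sh oXd (cap (ev_Xd C) R) \c xing oX oXd (oXd :: R) =
  cap (ev_Xd C) (oXd :: R) \c sh oX (xingV oXd oXd R).
  by rewrite cap_xing_slide.
rewrite !(expand_rules, sh_comp) -!compoA.
rewrite ![sh oXd (xing _ _ _) \c cup _ _ \c _]compoA !E1 -!compoA.
rewrite ![sh oXd (cap _ _) \c xing _ _ _ \c _]compoA !E2 -!compoA.
rewrite !zigzag_Xd_l_tail !xingKVl.
rewrite -![sh oX (xingV _ _ _) \c sh oX _]sh_comp !xingVK !sh1 !comp1r braid.
rewrite !xingV_Xd !expand_rules !shN !expand_rules.
lin_coefs; field; case: HP => al0 be0 _ _ _; by rewrite al0 be0.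
Qed.

Lemma u_neq0 : u != 0.
Proof.
apply: contra_eq_neq uv => ->; rewrite mul0r eq_sym oppr_eq0.
by rewrite mulf_neq0 ?ka'_neq0 // mulf_neq0 ?ka_neq0 ?albe_neq0.
Qed.

Lemma v_neq0 : v != 0.
Proof.
apply: contra_eq_neq uv => ->; rewrite mulr0 eq_sym oppr_eq0.
by rewrite mulf_neq0 ?ka'_neq0 // mulf_neq0 ?ka_neq0 ?albe_neq0.
Qed.

(** One strand leaves and the other returns, so their mutual crossing carries the product of the
    parameters instead of the ratio. *)
Lemma braid_TS x z w R :
  sh oXd (crossT x z R) \c crossR (z * w - 1) (al + be) (x :: R) \c sh oXd (crossS x w R) =
  crossS x w (oXd :: R) \c sh x (crossR (z * w - 1) (al + be) R) \c crossT x z (oXd :: R).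
Proof.
case: x; last first.
  by rewrite !crossT_Xd !crossS_Xd; apply: crossR_braid; ring.
change true with oX.
rewrite !crossT_X !crossS_X /crossR !(expand_rules, sh_comp) -!compoA.
(* The local facts evaluate curls, loops, twists and double crossings; the tail [h] lets them
   rewrite inside longer composites. *)
have slide_cap A (h : Hom C A _) : sh oXd (cap (ev_dX C) R) \c xing oXd oXd (oX :: R) \c h =
  cap (ev_dX C) (oXd :: R) \c sh oXd (xingV oX oXd R) \c h.
  by rewrite compoA cap_xing_slide -compoA.
have slide_cup A (h : Hom C A _) :
  xing oX oXd (oXd :: R) \c sh oX (xing oXd oXd R) \c cup (coev_Xd C) (oXd :: R) \c h =
  sh oXd (cup (coev_Xd C) R) \c h.
  by rewrite sh_cup_slide -!compoA.
have curl A (h : Hom C A _) : sh oXd (cap (ev_dX C) R) \c xing oXd oXd (oX :: R) \c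
    sh oXd (cup (coev_dX C) R) \c h = ka^-1 *: h.
  by rewrite -[in RHS](comp1l h) -!bilin -curl_dX -!compoA.
have curl' A (h : Hom C A _) : cap (ev_Xd C) (oXd :: R) \c sh oX (xing oXd oXd R) \c
    cup (coev_Xd C) (oXd :: R) \c h = ka'^-1 *: h.
  by rewrite -[in RHS](comp1l h) -!bilin -lclose_xing /lclose -!compoA.
have loop A (h : Hom C A _) : sh oXd (cap (ev_dX C) R) \c sh oXd (cup (coev_dX C) R) \c h =
    ((th + 1) / (ka * (al + be))) *: h.
  by rewrite compoA -sh_comp loop_dX !expand_rules.
have loop' A (h : Hom C A _) : cap (ev_Xd C) (oXd :: R) \c cup (coev_Xd C) (oXd :: R) \c h =
    ((th + 1) / (ka' * (al + be))) *: h.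
  by rewrite compoA loop_Xd !expand_rules.
have coev A (h : Hom C A _) : sh oXd (xing oXd oX R) \c sh oXd (cup (coev_dX C) R) \c h =
    ka' *: (sh oXd (cup (coev_Xd C) R) \c h).
  by rewrite compoA -sh_comp xing_coev_dX !expand_rules.
have coev' A (h : Hom C A _) : xing oX oXd (oXd :: R) \c cup (coev_Xd C) (oXd :: R) \c h =
    ka *: (cup (coev_dX C) (oXd :: R) \c h).
  by rewrite compoA xing_coev_Xd !expand_rules.
have ev : sh oXd (cap (ev_dX C) R) \c sh oXd (xing oX oXd R) = ka' *: sh oXd (cap (ev_Xd C) R).
  by rewrite -sh_comp ev_dX_xing shZ.
have dbl : sh oXd (xing oXd oX R) \c sh oXd (xing oX oXd R) = (al * be)^-1 *:
    (((al + be) * ka') *: (sh oXd (cup (coev_Xd C) R) \c sh oXd (cap (ev_Xd C) R)) - 1_ _).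
  have := xing_XdX_XXd R; move/(congr1 (fun h => (al * be)^-1 *: sh oXd h)).
  by rewrite !(shZ, shD, shN) sh1 scalerA mulVf ?albe_neq0 // scale1r !sh_comp.
have dbl' : xing oX oXd (oXd :: R) \c xing oXd oX (oXd :: R) = (al * be)^-1 *:
    (((al + be) * ka) *: (cup (coev_dX C) (oXd :: R) \c cap (ev_dX C) (oXd :: R)) - 1_ _).
  have := xing_XXd_XdX (oXd :: R); move/(congr1 (fun h => (al * be)^-1 *: h)).
  by rewrite scalerA mulVf ?albe_neq0 // scale1r.
rewrite !curl !curl' !loop !loop' !coev !coev' !ev !ev_Xd_xing dbl dbl' !expand_rules.
rewrite braid xing_cup_slide_tail sh_xingKVl slide_cap slide_cup -sh_cap_slide.
rewrite -[sh oXd (xingV _ _ _) \c _]sh_comp xingVK sh1 comp1r.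
(* The remaining coefficient identities rest on [u * v = - th], used by eliminating [v]. *)
have -> : v = - th / u by rewrite -uv mulrC mulKf ?u_neq0.
have := u_neq0; case: HP => al0 be0 p0 k0 k'0 u_neq0.
lin_coefs; field; by rewrite ?al0 ?be0 ?p0 ?k0 ?k'0 ?u_neq0.
Qed.

(** * Dressing and the reflection equation *)

Lemma at2_sh_tail a b c d (f : Hom C [:: a; b] [:: c; d]) P Q (g : Hom C P Q) A (h : Hom C A _) :
  at2 f Q \c sh a (sh b g) \c h = sh c (sh d g) \c at2 f P \c h.
Proof. by rewrite compoA at2_sh -compoA. Qed.

Lemma braid_S_tail x z w (c : K) R A (h : Hom C A _) :
  crossR (z - w) (w * (al + be)) (x :: R) \c
    sh oXd (crossS x (c * z) R) \c crossS x (c * w) (oXd :: R) \c h =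
  sh oXd (crossS x (c * w) R) \c crossS x (c * z) (oXd :: R) \c
    sh x (crossR (z - w) (w * (al + be)) R) \c h.
Proof. by have := congr1 (fun f => f \c h) (braid_S x z w c R); rewrite -!compoA. Qed.

Lemma braid_TS_tail x z w R A (h : Hom C A _) :
  sh oXd (crossT x z R) \c crossR (z * w - 1) (al + be) (x :: R) \c sh oXd (crossS x w R) \c h =
  crossS x w (oXd :: R) \c sh x (crossR (z * w - 1) (al + be) R) \c crossT x z (oXd :: R) \c h.
Proof. by have := congr1 (fun f => f \c h) (braid_TS x z w R); rewrite -!compoA. Qed.

(** The operator [S_w T_z] without its poles, hence polynomial in the parameters. Recursion on the
    first letter makes dressing an induction on the word. *)
Fixpoint monodromy V z w : Hom C (oXd :: V) (oXd :: V) :=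
  match V return Hom C (oXd :: V) (oXd :: V) with
  | [::] => 1_ [:: oXd]
  | x :: V' => crossS x w V' \c sh x (monodromy V' z w) \c crossT x z V'
  end.

Lemma crossR_comm y e y' e' R : crossR y e R \c crossR y' e' R = crossR y' e' R \c crossR y e R.
Proof. by rewrite /crossR !expand_rules; lin_coefs; ring. Qed.

(** The left factor is the conjugate of [crossR y e] under exchange of the two roots of the
    quadratic relation, and the scalar is the norm: [crossR y e] is invertible when it is
    nonzero. *)
Lemma crossR_quad y e R :
  crossR (- y) (e + y * (al + be)) R \c crossR y e R =
  (al * be * y ^+ 2 + e ^+ 2 + e * y * (al + be)) *: 1_ _.
Proof. by rewrite /crossR !expand_rules xing_Xd_sqr; lin_coefs; ring. Qed.

Lemma reflection V z w rho :
  crossR (z - w) (w * (al + be)) V \c sh oXd (monodromy V z (rho * z)) \c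
    crossR (rho * z * w - 1) (al + be) V \c sh oXd (monodromy V w (rho * w)) =
  sh oXd (monodromy V w (rho * w)) \c crossR (rho * z * w - 1) (al + be) V \c
    sh oXd (monodromy V z (rho * z)) \c crossR (z - w) (w * (al + be)) V.
Proof.
elim: V => [|x V IHV]; first by rewrite /= !sh1 !comp1r !comp1l crossR_comm.
rewrite [monodromy (_ :: _) z _]/= [monodromy (_ :: _) w _]/= !sh_comp -!compoA.
have -> : rho * z * w - 1 = z * (rho * w) - 1 by ring.
rewrite braid_TS_tail.
(* The dressing crossings are attached to the induction hypothesis, and [braid_T] brings its
   right-hand end into the form met in the goal. *)
have {}IHV := congr1 (fun f => sh x f \c crossT x z (oXd :: V) \c sh oXd (crossT x w V)) IHV.
rewrite !sh_comp -!compoA braid_T in IHV.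
rewrite -[sh oXd (sh x _) \c crossS x _ _ \c _]at2_sh_tail.
rewrite [crossT x z _ \c sh oXd (sh x _) \c _]at2_sh_tail braid_S_tail.
have -> : z * (rho * w) - 1 = rho * z * w - 1 by ring.
rewrite IHV.
(* The middle parameter is symmetric in [z] and [w] because both return parameters carry the same
   [rho]; hence [braid_TS] applies again with the roles exchanged. *)
have -> : rho * z * w - 1 = w * (rho * z) - 1 by ring.
rewrite braid_TS_tail -[sh oXd (sh x _) \c crossS x _ _ \c _]at2_sh_tail.
by rewrite [crossT x w _ \c sh oXd (sh x _) \c _]at2_sh_tail.
Qed.

(** * Partial closures and commutation *)

Lemma lcloseD A B (f g : Hom C (oXd :: A) (oXd :: B)) : lclose (f + g) = lclose f + lclose g.
Proof. by rewrite /lclose !expand_rules. Qed.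

Lemma lcloseZ A B x (f : Hom C (oXd :: A) (oXd :: B)) : lclose (x *: f) = x *: lclose f.
Proof. by rewrite /lclose !expand_rules. Qed.

Lemma lclose_shl A B D (x : Hom C B D) (f : Hom C (oXd :: A) (oXd :: B)) :
  lclose (sh oXd x \c f) = x \c lclose f.
Proof. by rewrite /lclose sh_comp !compoA cap_sh. Qed.

Lemma lclose_shr A B D (x : Hom C A B) (f : Hom C (oXd :: B) (oXd :: D)) :
  lclose (f \c sh oXd x) = lclose f \c x.
Proof. by rewrite /lclose sh_comp -!compoA cup_sh. Qed.

Lemma lclose1 A : lclose (1_ (oXd :: A)) = ((th + 1) / (ka' * (al + be))) *: 1_ A.
Proof. by rewrite /lclose sh1 comp1l loop_Xd. Qed.

(** The closed strand slides across its neighbour at the cap and at the cup; the two new crossings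
    meet after passing [f] and cancel. *)
Lemma lclose_conj A B (f : Hom C (oXd :: A) (oXd :: B)) :
  lclose (xing oXd oXd B \c sh oXd f \c xingV oXd oXd A) = sh oXd (lclose f).
Proof.
rewrite /lclose !sh_comp -!compoA compoA -cap_xingV_slide -xing_cup_slide -!compoA.
by rewrite at2_sh_tail xingVKl.
Qed.

(** The crossing slides over the nested caps to become a crossing of the two returning [oX] strands,
    passes [f], and comes back through the nested cups. *)
Lemma lclose_lclose_xing A B (f : Hom C (oXd :: oXd :: A) (oXd :: oXd :: B)) :
  lclose (lclose (xing oXd oXd B \c f)) = lclose (lclose (f \c xing oXd oXd A)).
Proof.
have capE : cap (ev_Xd C) B \c sh oX (cap (ev_Xd C) (oXd :: B)) \c sh oX (sh oX (xing oXd oXd B))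
    = cap (ev_Xd C) B \c sh oX (cap (ev_Xd C) (oXd :: B)) \c xing oX oX (oXd :: oXd :: B).
  rewrite -sh_comp -cap_xingV_slide sh_comp compoA cap_sh -compoA.
  by rewrite cap_xing_slide.
have cupE : sh oX (sh oX (xing oXd oXd A)) \c sh oX (cup (coev_Xd C) (oXd :: A)) \c cup (coev_Xd C) A
    = xing oX oX (oXd :: oXd :: A) \c sh oX (cup (coev_Xd C) (oXd :: A)) \c cup (coev_Xd C) A.
  rewrite compoA -sh_comp -xingV_cup_slide sh_comp -compoA cup_sh compoA.
  by rewrite -xing_cup_slide -compoA.
rewrite /lclose !sh_comp -!compoA cupE.
rewrite -[sh oX (sh oX f) \c xing _ _ _ \c _]at2_sh_tail.
have := congr1 (fun k => k \c sh oX (sh oX f) \c sh oX (cup (coev_Xd C) (oXd :: A))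
  \c cup (coev_Xd C) A) capE.
by rewrite -!compoA.
Qed.

Lemma lclose_lclose_crossR y e A B (f : Hom C (oXd :: oXd :: A) (oXd :: oXd :: B)) :
  lclose (lclose (crossR y e B \c f)) = lclose (lclose (f \c crossR y e A)).
Proof. by rewrite /crossR !expand_rules !(lcloseD, lcloseZ) lclose_lclose_xing. Qed.

Lemma lclose_crossR y e R : lclose (crossR y e R) =
  (y / ka' + e * ((th + 1) / (ka' * (al + be)))) *: 1_ (oXd :: R).
Proof. by rewrite /crossR lcloseD !lcloseZ lclose_xing lclose1 !scalerA scalerDl. Qed.

(* Conjugating by the inverse of the first [crossR], the reflection equation says that
   the double closure of [h D_1 L' D'_1] is symmetric in [D, D'] for [h = 1] and [h = g^-1]. *)
Lemma lclose_comm V y e y' e' (D D' : Hom C (oXd :: V) (oXd :: V)) :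
  crossR y e V \c sh oXd D \c crossR y' e' V \c sh oXd D' =
    sh oXd D' \c crossR y' e' V \c sh oXd D \c crossR y e V ->
  al * be * y ^+ 2 + e ^+ 2 + e * y * (al + be) != 0 ->
  y' != 0 -> y' / ka' + e' * ((th + 1) / (ka' * (al + be))) != 0 ->
  lclose D \c lclose D' = lclose D' \c lclose D.
Proof.
move=> RE N0 y'0 k0.
(* The conjugate factor inverts [crossR y e] up to the scalar of [N0]. It commutes with
   [crossR s t], and cyclicity brings the surplus [crossR y e] round to meet it. *)
have tr s t : lclose (lclose (crossR s t V \c sh oXd D \c crossR y' e' V \c sh oXd D')) =
              lclose (lclose (crossR s t V \c sh oXd D' \c crossR y' e' V \c sh oXd D)).
  apply: (scalerI N0); rewrite -!lcloseZ.
  have -> : (al * be * y ^+ 2 + e ^+ 2 + e * y * (al + be)) *: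
      (crossR s t V \c sh oXd D \c crossR y' e' V \c sh oXd D') =
      (crossR (- y) (e + y * (al + be)) V \c crossR s t V) \c
      (sh oXd D' \c crossR y' e' V \c sh oXd D) \c crossR y e V.
    rewrite -!compoA -RE -(comp1l (crossR s t V \c _)) -compZl -crossR_quad.
    by rewrite -!compoA; congr (_ \c _); rewrite !compoA crossR_comm.
  rewrite [X in lclose (lclose X) = _]compoA -lclose_lclose_crossR !compoA.
  rewrite [crossR y e V \c crossR (- y) _ V]crossR_comm crossR_quad.
  by rewrite -!compoA compZl comp1l.
(* The case [h = 1]: closing the first strand turns the middle crossing into the scalar of [k0]. *)
have E : lclose (D \c D') = lclose (D' \c D).
  apply: (scalerI k0); have := tr 0 1.
  rewrite /crossR !scale0r !add0r !scale1r !comp1l -/(crossR y' e' V).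
  by rewrite !lclose_shl !lclose_shr lclose_crossR !bilin !comp1l !lcloseZ.
have P (F F' : Hom C (oXd :: V) (oXd :: V)) :
   lclose (lclose (sh oXd F \c xing oXd oXd V \c sh oXd F' \c xingV oXd oXd V)) =
   lclose F \c lclose F'.
  by rewrite lclose_shl lclose_conj lclose_shr.
have xV : xingV oXd oXd V = crossR (- (al * be)^-1) ((al * be)^-1 * (al + be)) V.
  by rewrite xingV_Xd /crossR scalerBr scalerA addrC scaleNr.
have := tr (- (al * be)^-1) ((al * be)^-1 * (al + be)).
(* The case of the inverse crossing: by cyclicity it moves to the right end, where the crossing term
   of [crossR y' e'] gives the product of closures and its identity term a multiple of the closure
   of the product. *)
have T (F F' : Hom C (oXd :: V) (oXd :: V)) :
   lclose (lclose (crossR (- (al * be)^-1) ((al * be)^-1 * (al + be)) V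
   \c sh oXd F \c crossR y' e' V \c sh oXd F')) = y' *: (lclose F \c lclose F') +
   (e' * (- (al * be)^-1 / ka' +
     (al * be)^-1 * (al + be) * ((th + 1) / (ka' * (al + be))))) *: lclose (F \c F').
  rewrite lclose_lclose_crossR -P xV.
  rewrite -xV -!compoA /crossR !expand_rules !(lcloseD, lcloseZ); congr (_ + _).
  rewrite xV compoA -sh_comp lclose_shl lclose_crossR !bilin comp1r !lcloseZ scalerA.
  by [].
(* The closures of products agree by [E] and cancel, as does [y']. *)
rewrite !T E => /addIr; exact: scalerI.
Qed.

(** * Polynomiality in the spectral parameter *)

Lemma poly_map_crossS x rho R : poly_map (fun z => crossS x (rho * z) R).
Proof.
case: x.
- have E z := crossS_X (rho * z) R.
  apply: (poly_map_ext E); exact: poly_map_affine.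
- have E z := crossS_Xd (rho * z) R.
  apply: (poly_map_ext E); exact: poly_map_affine.
Qed.

Lemma poly_map_crossT x R : poly_map (fun z => crossT x z R).
Proof.
case: x.
(* The factor [1] gives the coefficient the shape [a * z - b] of [poly_map_affine]. *)
- have E z := crossT_X (1 * z) R.
  apply: (@poly_map_ext _ _ _ (fun z => crossT oX (1 * z) R)) => [z|].
    by rewrite mul1r.
  apply: (poly_map_ext E); exact: poly_map_affine.
- have E z := crossT_Xd (1 * z) R.
  apply: (@poly_map_ext _ _ _ (fun z => crossT oXd (1 * z) R)) => [z|].
    by rewrite mul1r.
  apply: (poly_map_ext E); exact: poly_map_affine.
Qed.

Lemma poly_map_comp A B D (F : K -> Hom C B D) (G : K -> Hom C A B) :
  poly_map F -> poly_map G -> poly_map (fun z => F z \c G z).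
Proof.
by apply: poly_map_bilin => *; rewrite !bilin.
Qed.

Lemma poly_map_monodromy V rho : poly_map (fun z => monodromy V z (rho * z)).
Proof.
elim: V => [|x V IHV] /=; first exact: poly_map_const.
apply: poly_map_comp; first exact: poly_map_crossS.
apply: poly_map_comp; last exact: poly_map_crossT.
by apply: poly_map_lin IHV => *; rewrite !expand_rules.
Qed.

Lemma lclose_monodromy_comm V rho z w :
  (forall p : {poly K}, p != 0 -> exists r, ~~ root p r) ->
  lclose (monodromy V z (rho * z)) \c lclose (monodromy V w (rho * w)) =
  lclose (monodromy V w (rho * w)) \c lclose (monodromy V z (rho * z)).
Proof.
move=> nonroot; apply/eqP; rewrite -subr_eq0; apply/eqP; move: z.
(* For fixed [w], these are the three scalars required nonzero in [lclose_comm], as polynomials in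
   [z]; the third is multiplied by [ka']. *)
pose q1 : {poly K} := (al * be) *: ('X - w%:P) ^+ 2 + ((al + be) ^+ 2 * w) *: 'X.
pose q2 : {poly K} := (rho * w) *: 'X - 1%:P.
pose q3 : {poly K} := (rho * w) *: 'X + th%:P.
have nz (p : {poly K}) a : p.[a] != 0 -> p != 0.
  by apply: contra_neq => ->; rewrite horner0.
have E1 z : q1.[z] = al * be * (z - w) ^+ 2 + (al + be) ^+ 2 * w * z.
  by rewrite hornerD !hornerZ horner_exp hornerXsubC hornerX.
have E2 z : q2.[z] = rho * w * z - 1 by rewrite hornerD hornerN hornerZ hornerX hornerC.
have E3 z : q3.[z] = rho * w * z + th by rewrite hornerD hornerZ hornerX hornerC.
have th0 : th != 0 by rewrite !mulf_neq0 ?ka_neq0 ?ka'_neq0 //; case: HP.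
have q0 : q1 * q2 * q3 != 0.
  apply: mulf_neq0; first apply: mulf_neq0.
  (* The value at [0] is [al * be * w ^+ 2], which is useless for [w = 0]; the value at [1] serves
     there. *)
  - have [w0|w0] := boolP (w == 0).
      apply: (nz _ 1); rewrite E1 (eqP w0) subr0 expr1n mulr1 mulr0 mul0r addr0.
      exact: albe_neq0.
    apply: (nz _ 0); rewrite E1 mulr0 addr0 sub0r sqrrN.
    by rewrite mulf_neq0 ?expf_neq0 ?albe_neq0.
  - by apply: (nz _ 0); rewrite E2 mulr0 sub0r oppr_eq0 oner_neq0.
  - by apply: (nz _ 0); rewrite E3 mulr0 add0r.
apply: (poly_map_eq0 nonroot _ q0).
  pose F z := lclose (monodromy V z (rho * z)).
  have PF : poly_map F.
    by apply: poly_map_lin (poly_map_monodromy V rho) => *; rewrite ?lcloseD ?lcloseZ.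
  apply: poly_map_add; first exact: poly_map_comp PF (poly_map_const _).
  apply: (@poly_map_lin _ _ _ (fun f => - f)) => [x y|a x|]; rewrite ?opprD ?scalerN //.
  exact: poly_map_comp (poly_map_const _) PF.
move=> z; rewrite !rootM !negb_or => /andP[/andP[q1z q2z] q3z].
apply/eqP; rewrite subr_eq0; apply/eqP.
apply: lclose_comm (reflection V z w rho) _ _ _.
- move: q1z; rewrite rootE E1; congr (_ != 0); ring.
- move: q2z; rewrite rootE E2; congr (_ != 0); ring.
- apply: contra_neq q3z.
  have -> : (rho * z * w - 1) / ka' + (al + be) * ((th + 1) / (ka' * (al + be))) = q3.[z] / ka'.
    rewrite E3; field; rewrite ka'_neq0; by case: HP.
  by move/eqP; rewrite mulf_eq0 invr_eq0 (negbTE ka'_neq0) orbF => /eqP.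
Qed.

(** * Closing and dressing the generators *)

Lemma lclose_cup_cap R : lclose (cup (coev_dX C) R \c cap (ev_dX C) R) = 1_ (oX :: R).
Proof. by rewrite /lclose sh_comp -!compoA zigzag_X_r comp1r zigzag_X_l. Qed.

(** The skein relation replaces the second crossing by its inverse, so [lclose_conj] evaluates the
    term with two crossings; every other term closes to a multiple of [f]. *)
Lemma lclose_crossR_conj y e y' e' A B (f : Hom C (oXd :: A) (oXd :: B)) :
  exists a b : K, lclose (crossR y e B \c sh oXd f \c crossR y' e' A) = a *: f + b *: sh oXd (lclose f).
Proof.
have lcloseV R : exists k : K, lclose (xingV oXd oXd R) = k *: 1_ (oXd :: R).
  exists (- (al * be)^-1 / ka' + (al * be)^-1 * (al + be) * ((th + 1) / (ka' * (al + be)))).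
  rewrite -lclose_crossR; congr lclose.
  by rewrite xingV_Xd /crossR scalerBr scalerA addrC scaleNr.
have [k Ek] := lcloseV A.
have E1 : lclose (xing oXd oXd B \c sh oXd f) = ka'^-1 *: f.
  by rewrite lclose_shr lclose_xing !expand_rules.
have E2 : lclose (sh oXd f) = ((th + 1) / (ka' * (al + be))) *: f.
  by rewrite -[sh oXd f]comp1r lclose_shl lclose1 !expand_rules.
have E3 : lclose (sh oXd f \c xingV oXd oXd A) = k *: f by rewrite lclose_shl Ek !expand_rules.
exists (y * y' * (al + be) / ka' + y * e' / ka'
        + (e * y' * (al + be) + e * e') * ((th + 1) / (ka' * (al + be))) - e * y' * (al * be) * k).
exists (- (y * y' * (al * be))).
rewrite /crossR [xing oXd oXd A]xing_Xd_skein !expand_rules -!scaleN1r !(lcloseD, lcloseZ).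
rewrite lclose_conj E1 E2 E3.
by lin_coefs; ring.
Qed.

(** The double crossing is itself a combination of these two diagrams, by [xing_XXd_XdX], and a cup
    or cap absorbs any crossing next to it. *)
Lemma crossS_crossT_X w z R : exists a b : K, crossS oX w R \c crossT oX z R =
  a *: 1_ _ + b *: (cup (coev_dX C) R \c cap (ev_dX C) R).
Proof.
have E1 A (h : Hom C A _) : xing oX oXd R \c cup (coev_Xd C) R \c h = ka *: (cup (coev_dX C) R \c h).
  by rewrite compoA xing_coev_Xd !bilin.
have E2 A (h : Hom C A _) : cap (ev_Xd C) R \c cup (coev_Xd C) R \c h =
    ((th + 1) / (ka' * (al + be))) *: h.
  by rewrite compoA loop_Xd !expand_rules.
have E3 : xing oX oXd R \c xing oXd oX R = (al * be)^-1 *: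
    (((al + be) * ka) *: (cup (coev_dX C) R \c cap (ev_dX C) R) - 1_ _).
  by rewrite -xing_XXd_XdX scalerA mulVf ?albe_neq0 // scale1r.
exists (- ((w - v) * (z - u) / (al * be))).
exists ((w - v) * (z - u) * (al + be) * ka / (al * be)
  + (w - v) * ((al + be) / (al * be) * u) * ka + (z - u) * ((al + be) / (al * be) * v) * ka
  + (al + be) / (al * be) * v * ((al + be) / (al * be) * u) * ((th + 1) / (ka' * (al + be)))).
rewrite crossS_X crossT_X !expand_rules -!compoA E1 E2 ev_Xd_xing E3 !expand_rules.
by lin_coefs; ring.
Qed.

(** Dressing meets the cup of [E] here: the mixed crossing slides off and becomes a Hecke element on
    the [oX] strands. *)
Lemma crossS_cup w R : crossS oX w (oX :: R) \c sh oX (cup (coev_dX C) R) =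
  sh oXd ((w - v) *: xingV oX oX R + ((al + be) / (al * be) * v) *: 1_ _)
    \c cup (coev_dX C) (oX :: R).
Proof. by rewrite crossS_X !expand_rules -compoA zigzag_X_l xing_cup_slide comp1r. Qed.

Lemma cap_crossT z R : sh oX (cap (ev_dX C) R) \c crossT oX z (oX :: R) =
  cap (ev_dX C) (oX :: R)
    \c sh oXd ((z - u) *: xingV oX oX R + ((al + be) / (al * be) * u) *: 1_ _).
Proof. by rewrite crossT_X !expand_rules compoA zigzag_X_r cap_xing_slide comp1l. Qed.

End Diagrams.

(** * The transfer matrix as a closed monodromy *)

Section QuantumWalledBrauer.
Variables (C : catData CC).
Local Notation "f \c g" := (compo C f g) (at level 35, right associativity).
Local Notation "1_ A" := (idm C A) (at level 8, A at level 8).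
Hypothesis HC : braided_dual_cat C.
Variables (al be ka ka' : CC).
Hypothesis HP : [/\ al != 0, be != 0, al + be != 0, ka != 0 & ka' != 0].
Hypothesis HB : skein_relations C al be ka ka'.
Local Notation xing := (xing C) (only parsing).
Local Notation xingV := (xingV C) (only parsing).
Local Notation compoA := (compoA HC) (only parsing).
Local Notation comp1l := (comp1l HC) (only parsing).
Local Notation comp1r := (comp1r HC) (only parsing).
Local Notation tens_id := (tens_id HC) (only parsing).
Local Notation tensA := (tensA HC) (only parsing).
Local Notation tens1l := (tens1l HC) (only parsing).
Local Notation bilin := (bilin HC) (only parsing).
Local Notation shD := (shD HC) (only parsing).
Local Notation sh0 := (sh0 HC) (only parsing).
Local Notation shZ := (shZ HC) (only parsing).
Local Notation sh_comp := (sh_comp HC) (only parsing).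
Local Notation sh1 := (sh1 HC) (only parsing).
Local Notation at2Z := (at2Z HC) (only parsing).
Local Notation at2_cup_cap := (at2_cup_cap HC) (only parsing).
Local Notation at2_sh := (at2_sh HC) (only parsing).
Local Notation xing_X_skein := (xing_X_skein HC HB) (only parsing).
Local Notation crossR := (crossR C) (only parsing).
Local Notation at2_sh_tail := (at2_sh_tail HC) (only parsing).
Local Notation lcloseD := (lcloseD HC) (only parsing).
Local Notation lclose_shl := (lclose_shl HC) (only parsing).
Local Notation lclose_shr := (lclose_shr HC) (only parsing).
Local Notation lclose1 := (lclose1 HC HB) (only parsing).
Local Notation lclose_cup_cap := (lclose_cup_cap HC) (only parsing).
Local Notation lclose_crossR_conj := (lclose_crossR_conj HC HP HB) (only parsing).
Local Notation crossS_crossT_X := (crossS_crossT_X HC HP HB) (only parsing).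
Local Notation crossS_cup := (crossS_cup HC) (only parsing).
Local Notation cap_crossT := (cap_crossT HC) (only parsing).

Lemma castH_comp A B D A' B' D' (f : Hom C B D) (g : Hom C A B) :
  A = A' -> B = B' -> D = D' ->
  castH C (f \c g) = (castH C f : Hom C B' D') \c (castH C g : Hom C A' B').
Proof. by move=> <- <- <-; rewrite !castH_id. Qed.

Lemma castH_sh x A B A' B' (f : Hom C A B) : A = A' -> B = B' ->
  castH C (sh x f) = sh x (castH C f : Hom C A' B').
Proof. by move=> <- <-; rewrite !castH_id. Qed.

Lemma loc_nil a b c d (f : Hom C [:: a; b] [:: c; d]) R :
  loc [::] R f (a :: b :: R) (c :: d :: R) = at2 f R.
Proof. by rewrite /loc tens1l castH_id. Qed.

Lemma loc_cons x L R a b c d (f : Hom C [:: a; b] [:: c; d]) W W' :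
  W = L ++ [:: a, b & R] -> W' = L ++ [:: c, d & R] ->
  loc (x :: L) R f (x :: W) (x :: W') = sh x (loc L R f W W').
Proof.
move=> -> ->; rewrite /loc !castH_id.
have := tensA (1_ [:: x]) (1_ L) (tens C f (1_ R)).
by rewrite castH_id tens_id.
Qed.

Lemma insE (V : word) k : (k < size V)%N ->
  ins V k = take k V ++ [:: oXd, nth oX V k & drop k.+1 V].
Proof. by move=> lt_k; rewrite /ins (drop_nth oX lt_k). Qed.

Lemma insSE (V : word) k : (k < size V)%N ->
  ins V k.+1 = take k V ++ [:: nth oX V k, oXd & drop k.+1 V].
Proof. by move=> lt_k; rewrite /ins (take_nth oX lt_k) cat_rcons. Qed.

Lemma ins0 (V : word) : ins V 0 = oXd :: V.
Proof. by rewrite /ins take0 drop0. Qed.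

Lemma ins_size (V : word) : ins V (size V) = V ++ [:: oXd].
Proof. by rewrite /ins take_size drop_size. Qed.

Variables (u v : CC).

Lemma Tstep_cons x V z k : (k < size V)%N ->
  Tstep C al be u v (x :: V) z k.+1 = sh x (Tstep C al be u v V z k).
Proof.
move=> lt_k.
exact: (loc_cons x (Rx C al be u v oXd (nth oX V k) z) (insE lt_k) (insSE lt_k)).
Qed.

Lemma Sstep_cons x V z k : (k < size V)%N ->
  Sstep C al be u v (x :: V) z k.+1 = sh x (Sstep C al be u v V z k).
Proof.
move=> lt_k.
exact: (loc_cons x (Rx C al be u v (nth oX V k) oXd z) (insSE lt_k) (insE lt_k)).
Qed.

Lemma Tchain_cons x V z k : (k <= size V)%N ->
  Tchain C al be u v (x :: V) z k.+1 =
  sh x (Tchain C al be u v V z k) \c Tstep C al be u v (x :: V) z 0.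
Proof.
elim: k => [|k IHk] lt_k; first by rewrite /= sh1 comp1l comp1r.
rewrite [LHS]/= -/(Tchain C al be u v (x :: V) z k.+1) IHk ?(ltnW lt_k) //.
by rewrite (Tstep_cons x z lt_k) compoA -sh_comp.
Qed.

Lemma Schain_cons x V z k : (k <= size V)%N ->
  Schain C al be u v (x :: V) z k.+1 =
  Sstep C al be u v (x :: V) z 0 \c sh x (Schain C al be u v V z k).
Proof.
elim: k => [|k IHk] lt_k; first by rewrite /= sh1 comp1l comp1r.
rewrite [LHS]/= -/(Schain C al be u v (x :: V) z k.+1) IHk ?(ltnW lt_k) //.
by rewrite (Sstep_cons x z lt_k) -compoA -sh_comp.
Qed.

Lemma Tz_cons x V z : Tz C al be u v (x :: V) z =
  sh x (Tz C al be u v V z) \c at2 (Rx C al be u v oXd x z) V.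
Proof.
have e0 : ins (x :: V) 0 = [:: oXd, x & V] by [].
have e1 : x :: ins V 0 = [:: x, oXd & V] by rewrite ins0.
have e2 : x :: ins V (size V) = x :: V ++ [:: oXd] by rewrite ins_size.
rewrite /Tz [size _]/= (Tchain_cons x z (leqnn _)) (castH_comp _ _ e0 e1 e2).
congr (_ \c _); first exact: castH_sh (ins0 V) (ins_size V).
(* [take 0 V] and [drop 0 V] compute only once [V] is destructed. *)
by case: V {e0 e1 e2} => [|y V]; rewrite castH_id; apply: loc_nil.
Qed.

Lemma Sw_cons x V w : Sw C al be u v (x :: V) w =
  at2 (Rx C al be u v x oXd w) V \c sh x (Sw C al be u v V w).
Proof.
have e0 : ins (x :: V) 0 = [:: oXd, x & V] by [].
have e1 : x :: ins V 0 = [:: x, oXd & V] by rewrite ins0.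
have e2 : x :: ins V (size V) = x :: V ++ [:: oXd] by rewrite ins_size.
rewrite /Sw [size _]/= (Schain_cons x w (leqnn _)) (castH_comp _ _ e2 e1 e0).
congr (_ \c _); last exact: castH_sh (ins_size V) (ins0 V).
by case: V {e0 e1 e2} => [|y V]; rewrite castH_id; apply: loc_nil.
Qed.

Local Notation monodromy := (monodromy C al be u v).

Lemma Rx_T_scal x z : z != 1 -> (u != 0 -> z != u) -> u != 0 ->
  exists s : CC, Rx C al be u v oXd x z = s *: hatT C al be u x z.
Proof.
move=> z1 zu u_neq0; case: x.
  exists (z - u)^-1; rewrite scalerDr !scalerA mulVf ?subr_eq0 ?zu // scale1r.
  by congr (_ + _ *: _); rewrite [RHS]mulrC !mulrA.
exists (z - 1)^-1; rewrite scalerDr !scalerA mulVf ?subr_eq0 // scale1r.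
by congr (_ + _ *: _); rewrite mulrC.
Qed.

Lemma Rx_S_scal x z : z != 1 -> (v != 0 -> z != v) -> v != 0 ->
  exists s : CC, Rx C al be u v x oXd z = s *: hatS C al be v x z.
Proof.
move=> z1 zv v_neq0; case: x.
  exists (z - v)^-1; rewrite scalerDr !scalerA mulVf ?subr_eq0 ?zv // scale1r.
  by congr (_ + _ *: _); rewrite [RHS]mulrC !mulrA.
exists (z - 1)^-1; rewrite scalerDr !scalerA mulVf ?subr_eq0 // scale1r.
by congr (_ + _ *: _); rewrite mulrC.
Qed.

(** The scalar collects the inverse of one pole factor for each crossing. *)
Lemma Sw_Tz_monodromy V z w : z != 1 -> (u != 0 -> z != u) -> u != 0 ->
  w != 1 -> (v != 0 -> w != v) -> v != 0 ->
  exists s : CC, Sw C al be u v V w \c Tz C al be u v V z = s *: monodromy V z w.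
Proof.
move=> z1 zu u_neq0 w1 wv v_neq0; elim: V => [|x V [s IHV]].
  by exists 1; rewrite /Sw /Tz /= !castH_id comp1l scale1r.
have [a Ea] := Rx_T_scal x z1 zu u_neq0.
have [b Eb] := Rx_S_scal x w1 wv v_neq0.
exists (b * (s * a)); rewrite Tz_cons Sw_cons Ea Eb -!compoA [sh x _ \c sh x _ \c _]compoA.
rewrite -sh_comp IHV shZ !at2Z !bilin !scalerA.
by congr (_ *: _); ring.
Qed.

Lemma Amn_lclose m n z w : Amn C al be ka u v m n z w = (ka * (al + be))^-1 *:
  lclose (Sw C al be u v (Vmn m n) w \c Tz C al be u v (Vmn m n) z).
Proof. by rewrite /lclose sh_comp -compoA. Qed.

(** * Membership in the quantum walled Brauer algebra *)

Lemma word_split2 (V : word) k : (k.+1 < size V)%N ->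
  V = take k V ++ [:: nth oX V k, nth oX V k.+1 & drop k.+2 V].
Proof.
move=> lt_k; rewrite -{1}(cat_take_drop k V) (drop_nth oX (ltnW lt_k)).
by rewrite (drop_nth oX lt_k).
Qed.

Lemma nth_Vmn m n k : nth oX (Vmn m n) k = ~~ (k < m)%N.
Proof.
rewrite nth_cat size_nseq nth_nseq; case: ltnP => // _.
by rewrite nth_nseq if_same.
Qed.

Lemma size_Vmn m n : size (Vmn m n) = (m + n)%N.
Proof. by rewrite size_cat !size_nseq. Qed.

Lemma loc_Vmn_cons x m n k a b (f : Hom C [:: a; b] [:: a; b]) :
  (k.+1 < m + n)%N -> (k < m)%N = ~~ a -> (k.+1 < m)%N = ~~ b ->
  loc (take k.+1 (x :: Vmn m n)) (drop k.+3 (x :: Vmn m n)) f (x :: Vmn m n) (x :: Vmn m n) =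
  sh x (loc (take k (Vmn m n)) (drop k.+2 (Vmn m n)) f (Vmn m n) (Vmn m n)).
Proof.
move=> lt_k Ea Eb; apply: loc_cons;
  by rewrite -[a]negbK -[b]negbK -Ea -Eb -!(nth_Vmn m n) -word_split2 ?size_Vmn.
Qed.

Local Notation qwB m n := (@in_qwB C m n).

Lemma qwB_0 m n : qwB m n 0.
Proof. by have := qwB_scale 0 (qwB_id C m n); rewrite scale0r. Qed.

(** No word containing the cup fits [Vmn 0 n], so [castH] takes its default value. Thus [qwB 0 n] is
    generated by the [h_i] alone. *)
Lemma gen_E0 n : gen_E C 0 n = 0.
Proof. by apply: castH_neq; case: n. Qed.

Lemma qwB_sh_Xd m n f : qwB m n.+1 f -> qwB m.+1 n.+1 (sh oXd f).
Proof.
elim=> {f} [|j lt_j|i lt_i||f g _ IHf _ IHg|a f _ IHf|f g _ IHf _ IHg].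
- by rewrite sh1; apply: qwB_id.
- have := @qwB_g C m.+1 n.+1 j; rewrite ltnS; case/andP: lt_j => j1 jm.
  rewrite j1 (ltnW jm) => /(_ isT).
  (* The label [j] counts from the wall and the position from the left end: a new leftmost factor
     keeps the label and shifts the position. *)
  have e : (m.+1 - j.+1 = (m - j.+1).+1)%N by lia.
  have lt_k : ((m - j.+1).+1 < m + n.+1)%N by lia.
  have h1 : (m - j.+1 < m)%N = true by lia.
  have h2 : ((m - j.+1).+1 < m)%N = true by lia.
  by rewrite -(loc_Vmn_cons oXd (br C [:: oXd] [:: oXd]) lt_k h1 h2) /gen_g e.
- have := @qwB_h C m.+1 n.+1 i lt_i; case/andP: lt_i => i1 lt_i.
  have e : (m.+1 + i - 1 = (m + i - 1).+1)%N by lia.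
  have lt_k : ((m + i - 1).+1 < m + n.+1)%N by lia.
  have h1 : (m + i - 1 < m)%N = false by lia.
  have h2 : ((m + i - 1).+1 < m)%N = false by lia.
  by rewrite -(loc_Vmn_cons oXd (br C [:: oX] [:: oX]) lt_k h1 h2) /gen_h e.
- case: m => [|m]; first by rewrite gen_E0 sh0; apply: qwB_0.
  have := qwB_E C m.+2 n.+1.
  have lt_k : (m.+1 < m.+1 + n.+1)%N by lia.
  have h1 : (m < m.+1)%N = true by lia.
  have h2 : (m.+1 < m.+1)%N = false by lia.
  by rewrite /gen_E !subn1 -(loc_Vmn_cons oXd (coev_dX C \c ev_dX C) lt_k h1 h2).
- by rewrite shD; apply: qwB_add.
- by rewrite shZ; apply: qwB_scale.
- by rewrite sh_comp; apply: qwB_comp.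
Qed.

Lemma qwB_sh_X n f : qwB 0 n f -> qwB 0 n.+1 (sh oX f).
Proof.
elim=> {f} [|j lt_j|i lt_i||f g _ IHf _ IHg|a f _ IHf|f g _ IHf _ IHg].
- by rewrite sh1; apply: qwB_id.
- by case/andP: lt_j.
(* The new leftmost [oX] takes label 1, so every [h_i] becomes [h_{i+1}]. *)
- have := @qwB_h C 0 n.+1 i.+1; case/andP: lt_i => i1 lt_i.
  rewrite !ltnS lt_i => /(_ isT).
  have e : (0 + i.+1 - 1 = (0 + i - 1).+1)%N by lia.
  have lt_k : ((0 + i - 1).+1 < 0 + n)%N by lia.
  have h1 : (0 + i - 1 < 0)%N = false by lia.
  have h2 : ((0 + i - 1).+1 < 0)%N = false by lia.
  by rewrite -(loc_Vmn_cons oX (br C [:: oX] [:: oX]) lt_k h1 h2) /gen_h e.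
- by rewrite gen_E0 sh0; apply: qwB_0.
- by rewrite shD; apply: qwB_add.
- by rewrite shZ; apply: qwB_scale.
- by rewrite sh_comp; apply: qwB_comp.
Qed.

Lemma qwB_xing_Xd m n : qwB m.+2 n (xing oXd oXd (Vmn m n)).
Proof.
have := @qwB_g C m.+2 n m.+1; rewrite ltnSn => /(_ isT).
by rewrite /gen_g subnn /= drop0 loc_nil.
Qed.

Lemma qwB_xing_X n : qwB 0 n.+2 (xing oX oX (Vmn 0 n)).
Proof.
have := @qwB_h C 0 n.+2 1 isT.
by rewrite /gen_h /= drop0 loc_nil.
Qed.

Lemma qwB_xingV_X n : qwB 0 n.+2 (xingV oX oX (Vmn 0 n)).
Proof.
have -> : xingV oX oX (Vmn 0 n) =
    (al * be)^-1 *: ((al + be) *: 1_ (oX :: oX :: Vmn 0 n) + (-1) *: xing oX oX (Vmn 0 n)).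
  rewrite xing_X_skein; lin_coefs; field; by case: HP => -> -> _ _ _.
apply: qwB_scale; apply: qwB_add; apply: qwB_scale; first exact: qwB_id.
exact: qwB_xing_X.
Qed.

Local Notation cupcap R := (cup (coev_dX C) R \c cap (ev_dX C) R).

Lemma qwB_cupcap n : qwB 1 n.+1 (cupcap (Vmn 0 n)).
Proof.
have := qwB_E C 1 n.+1.
by rewrite /gen_E /= drop0 loc_nil at2_cup_cap.
Qed.

(** The bimodule [H + H E H] over the Hecke algebra [H]; scalars are absorbed into [x]. *)
Inductive hecke_E_span n : Hom C (oXd :: Vmn 0 n.+1) (oXd :: Vmn 0 n.+1) -> Prop :=
| hspan_sh x : qwB 0 n.+1 x -> hecke_E_span (sh oXd x)
| hspan_E x y : qwB 0 n.+1 x -> qwB 0 n.+1 y ->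
    hecke_E_span (sh oXd x \c cupcap (Vmn 0 n) \c sh oXd y)
| hspan_add f g : hecke_E_span f -> hecke_E_span g -> hecke_E_span (f + g).

Lemma hspan_qwB n f : @hecke_E_span n f -> qwB 1 n.+1 f.
Proof.
elim=> {f} [x Qx|x y Qx Qy|f g _ IHf _ IHg]; last exact: qwB_add.
  exact: qwB_sh_Xd.
apply: qwB_comp; first exact: qwB_sh_Xd.
apply: qwB_comp; last exact: qwB_sh_Xd.
exact: qwB_cupcap.
Qed.

(** The closure is a bimodule map over [H], and [E] closes to the identity. *)
Lemma hspan_lclose n f : @hecke_E_span n f -> qwB 0 n.+1 (lclose f).
Proof.
elim=> {f} [x Qx|x y Qx Qy|f g _ IHf _ IHg]; last by rewrite lcloseD; apply: qwB_add.
  by rewrite -[sh oXd x]comp1r lclose_shl lclose1 !bilin comp1r; apply: qwB_scale.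
rewrite compoA lclose_shr lclose_shl lclose_cup_cap -compoA comp1l.
exact: qwB_comp.
Qed.

Lemma hspan_scal n a b x : qwB 0 n.+1 x ->
  @hecke_E_span n (sh oXd x \c (a *: 1_ _ + b *: cupcap (Vmn 0 n))).
Proof.
move=> Qx; rewrite !bilin comp1r -!shZ; apply: hspan_add.
  by apply: hspan_sh; apply: qwB_scale.
have -> : b *: (sh oXd x \c cupcap (Vmn 0 n)) =
    sh oXd (b *: x) \c cupcap (Vmn 0 n) \c sh oXd (1_ _).
  by rewrite sh1 comp1r shZ !bilin.
by apply: hspan_E; [apply: qwB_scale|apply: qwB_id].
Qed.

Local Notation crossT := (crossT C al be u).
Local Notation crossS := (crossS C al be v).

(** Elements of [H] pass through the crossings, which then merge by [crossS_crossT_X]. In [H E H]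
    the cup and the cap are pulled through separately, each leaving a Hecke factor. *)
Lemma hspan_dress n f z w : @hecke_E_span n f ->
  @hecke_E_span n.+1 (crossS oX w (Vmn 0 n.+1) \c sh oX f \c crossT oX z (Vmn 0 n.+1)).
Proof.
elim=> {f} [x Qx|x y Qx Qy|f g _ IHf _ IHg].
- rewrite (at2_sh_tail (hatS C al be v oX w)).
  have [a [b ->]] := crossS_crossT_X u v w z (Vmn 0 n.+1).
  by apply: hspan_scal; apply: qwB_sh_X.
- have -> : crossS oX w (Vmn 0 n.+1) \c
      sh oX (sh oXd x \c cupcap (Vmn 0 n) \c sh oXd y) \c crossT oX z (Vmn 0 n.+1) =
      sh oXd (sh oX x) \c (crossS oX w (oX :: Vmn 0 n) \c sh oX (cup (coev_dX C) (Vmn 0 n)))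
      \c (sh oX (cap (ev_dX C) (Vmn 0 n)) \c crossT oX z (oX :: Vmn 0 n)) \c sh oXd (sh oX y).
    rewrite !sh_comp -!compoA (at2_sh_tail (hatS C al be v oX w)).
    by rewrite (at2_sh (hatT C al be u oX z)).
  rewrite (crossS_cup al be v w) (cap_crossT al be u z) -!compoA.
  rewrite [sh oXd (sh oX x) \c _]compoA -!sh_comp.
  rewrite [cup _ _ \c _]compoA; apply: hspan_E; apply: qwB_comp; first exact: qwB_sh_X.
  - by apply: qwB_add; apply: qwB_scale; [apply: qwB_xingV_X|apply: qwB_id].
  - by apply: qwB_add; apply: qwB_scale; [apply: qwB_xingV_X|apply: qwB_id].
  exact: qwB_sh_X.
- by rewrite shD !bilin; apply: hspan_add.
Qed.

Lemma hspan_monodromy n z w : @hecke_E_span n (monodromy (Vmn 0 n.+1) z w).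
Proof.
elim: n => [|n IHn]; last exact: (hspan_dress z w IHn).
have [a [b E]] := crossS_crossT_X u v w z [::].
have := hspan_scal a b (qwB_id C 0 1); rewrite sh1 comp1l -E /= sh1 comp1l.
by [].
Qed.

(** The two claims are proved together because the closure at [m.+1] involves both the operator and
    its closure at [m]. *)
Lemma qwB_monodromy m n z w :
  qwB m.+1 n.+1 (monodromy (Vmn m n.+1) z w) /\ qwB m n.+1 (lclose (monodromy (Vmn m n.+1) z w)).
Proof.
elim: m => [|m [IH1 IH2]].
  by have H := hspan_monodromy n z w; split; [apply: hspan_qwB|apply: hspan_lclose].
have qwB_crossR y e : qwB m.+2 n.+1 (crossR y e (Vmn m n.+1)).
  apply: qwB_add; apply: qwB_scale; last exact: qwB_id.
  exact: qwB_xing_Xd.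
rewrite [monodromy (Vmn m.+1 n.+1) z w]/= (crossS_Xd HC al be v) (crossT_Xd HC al be u); split.
  apply: qwB_comp; first exact: qwB_crossR.
  apply: qwB_comp; last exact: qwB_crossR.
  exact: qwB_sh_Xd.
have [a [b ->]] :=
  lclose_crossR_conj (w - 1) (al + be) (z - 1) (al + be) (monodromy (Vmn m n.+1) z w).
by apply: qwB_add; apply: qwB_scale => //; apply: qwB_sh_Xd.
Qed.

End QuantumWalledBrauer.

Theorem theorem3p2p5 (C : catData CC) (al be ka ka' rho u v : CC) (m n : nat) :
  braided_dual_cat C ->
  al != 0 -> be != 0 -> al + be != 0 -> ka != 0 -> ka' != 0 ->
  B_relations C al be ka ka' ->
  (1 <= m)%N -> (1 <= n)%N ->
  u * v = - (al * be * ka * ka') ->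
  (forall z, regular_pt rho u v z ->
     @in_qwB C m n (Amn C al be ka u v m n z (rho * z))) /\
  (forall z w, regular_pt rho u v z -> regular_pt rho u v w ->
     compo C (Amn C al be ka u v m n z (rho * z)) (Amn C al be ka u v m n w (rho * w))
     - compo C (Amn C al be ka u v m n w (rho * w)) (Amn C al be ka u v m n z (rho * z)) = 0).
Proof.
move=> HC al0 be0 p0 ka0 ka'0 HB _ n_gt0 uv.
have HP : [/\ al != 0, be != 0, al + be != 0, ka != 0 & ka' != 0] by split.
pose D z := lclose (monodromy C al be u v (Vmn m n) z (rho * z)).
have AmnE z : regular_pt rho u v z ->
    exists s : CC, Amn C al be ka u v m n z (rho * z) = s *: D z.
  case=> z1 [zu [w1 wv]].
  have [s Es] := Sw_Tz_monodromy HC al be (Vmn m n) z1 zu (u_neq0 HP uv) w1 wv (v_neq0 HP uv).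
  by exists ((ka * (al + be))^-1 * s); rewrite (Amn_lclose HC) Es (lcloseZ HC) scalerA.
split=> [z /AmnE[s ->] | z w /AmnE[s ->] /AmnE[t ->]].
  apply: qwB_scale; case: n n_gt0 @D {AmnE} => [//|n _ D].
  exact: (qwB_monodromy HC HP HB u v m n z (rho * z)).2.
(* Algebraic closedness of [CC] supplies the non-roots that [poly_map_eq0] asks for. *)
have nonroot (p : {poly CC}) : p != 0 -> exists r, ~~ root p r.
  by move=> p_neq0; apply/closed_nonrootP.
rewrite !(bilin HC) !scalerA mulrC /D.
by rewrite (lclose_monodromy_comm HC HP HB uv (Vmn m n) rho z w nonroot) subrr.
Qed.
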